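(* Let $p\in(0,2)$, let $h$ satisfy $\lim_{t\to\infty}\frac{h'(t)}{t^{p-1}h(t)}=0$, and let $\{(\lambda_n,\mu_n,u_n)\}$ be a sequence of solutions (in the sense of the context) with $\mu_n\to\infty$ as $n\to\infty$. Then, up to a subsequence, \[ \lim_{n\to\infty}p\mu_n^{p-1}\int_0^1\lambda_nf(u_n)\,r\,dr=4,\qquad \lim_{n\to\infty}p\mu_n^{p-2}\int_0^1\lambda_nu_nf(u_n)\,r\,dr=4. \] Moreover, \[ \lim_{n\to\infty}\frac{\log\frac1{\lambda_n}}{\mu_n^p}=\frac{2-p}{2}; \] in particular $\lim_{n\to\infty}\lambda_n=0$. Finally, \[ \lim_{n\to\infty}p\mu_n^{p-1}u_n(r)=4\log\frac1r\quad\text{in }C^2_{\mathrm{loc}}((0,1]). \]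
   Context: $h:[0,\infty)\to\mathbb{R}$ is a nonnegative $C^1$ function and there is $t_0>0$ with $h(t)>0$ for all $t\ge t_0$; $f(t)=h(t)e^{t^p}$. A sequence of solutions $\{(\lambda_n,\mu_n,u_n)\}$ means: for every $n\in\mathbb N$, $\lambda_n>0$, $\mu_n>0$, and $u_n$ is a classical solution on $[0,1]$ of $-u_n''-\frac1r u_n'=\lambda_nf(u_n)$, $u_n>0$ in $(0,1)$, $u_n(0)=\mu_n$, $u_n'(0)=0=u_n(1)$. ''Up to a subsequence'' means after passing to a subsequence in $n$, not relabelled. *)

(* Defs.v *)
From Stdlib Require Import Reals.
From Coquelicot Require Import Coquelicot.
Open Scope R_scope.

(* [Rpower 0 p] is 1 in the standard library, whereas 0^p = 0 is meant here. *)
Definition rpow (t p : R) : R := if Rlt_dec 0 t then Rpower t p else 0.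

Definition exp_nonlinearity (p : R) (h : R -> R) (t : R) : R :=
  h t * exp (rpow t p).

(* Derivatives and continuity are relative to [D], hence one-sided at the
   endpoints of an interval; values outside [D] are irrelevant. *)
Definition derivative_on (D : R -> Prop) (g g' : R -> R) : Prop :=
  forall x, D x -> D_in g g' D x.

Definition continuous_on (D : R -> Prop) (g : R -> R) : Prop :=
  forall x, D x -> continue_in g D x.

Definition C1_on (D : R -> Prop) (g : R -> R) : Prop :=
  exists g', derivative_on D g g' /\ continuous_on D g'.

Definition is_solution (f : R -> R) (lambda mu : R) (u : R -> R) : Prop :=
  exists u' u'' : R -> R,
    derivative_on (fun r => 0 <= r <= 1) u u' /\
    derivative_on (fun r => 0 <= r <= 1) u' u'' /\
    continuous_on (fun r => 0 <= r <= 1) u'' /\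
    (forall r, 0 < r <= 1 -> - u'' r - 1 / r * u' r = lambda * f (u r)) /\
    (forall r, 0 < r < 1 -> 0 < u r) /\
    u 0 = mu /\ u' 0 = 0 /\ u 1 = 0.

Definition cvg_unif_on (K : R -> Prop) (v : nat -> R -> R) (w : R -> R) : Prop :=
  forall eps : posreal,
    eventually (fun n => forall x, K x -> Rabs (v n x - w x) < eps).

(* On a nondegenerate interval [D] the derivatives are unique, so the
   existential quantifiers involve no choice. *)
Definition cvg_C2_loc (D : R -> Prop) (v : nat -> R -> R) (w : R -> R) : Prop :=
  exists (v' v'' : nat -> R -> R) (w' w'' : R -> R),
    (forall n, derivative_on D (v n) (v' n) /\
               derivative_on D (v' n) (v'' n) /\ continuous_on D (v'' n)) /\
    (derivative_on D w w' /\ derivative_on D w' w'' /\ continuous_on D w'') /\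
    forall K : R -> Prop, compact K -> included K D ->
      cvg_unif_on K v w /\ cvg_unif_on K v' w' /\ cvg_unif_on K v'' w''.

(* Main.v *)
Require Import Defs.
From Stdlib Require Import Reals Lra Psatz IndefiniteDescription.
From Coquelicot Require Import Coquelicot.
Open Scope R_scope.

(** With [A = p mu^(p-1)], [z = A (mu - u)], [M = - A r u'] and
    [W = A lambda r^2 f(u)] the equation reads [r z' = M], [r M' = W],
    [r W' = W (2 - g M)] where [g = f'(u) / (A f(u))]. While [z <= Z] with [Z]
    fixed, [g] is close to 1, so [W] is close to [2 M - M^2 / 2]; this drives [M]
    close to 4 and [W] close to 0 before [z] reaches a large [Z]. From that
    radius [r0] on, [M >= M(r0)] gives [r / r0 <= exp ((z - Z) / M(r0))], about
    [exp ((z - Z) / 4)], while [f(u)] decays at least like [exp (- kappa z)] for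
    some [kappa > 1/2], because [min 1 p > p / 2]. Hence [W] decays exponentially
    in [z] and [M] stays close to 4 up to [r = 1]. Integrating [r z' = M] from
    [r0] to 1 gives [ln (1 / r0) ~ p mu^p / 4], and [lambda] is recovered from
    the size of [W] at [r0]. No subsequence is needed. *)

(** Up to lower order [A] is the logarithmic derivative of f at the maximum, and 4 is the nonzero
    root of [2 M - M^2 / 2]. The obstacle is the range of [z]: it runs up to [p mu^p], which tends
    to infinity, while linearising ln f at [mu] is legitimate only for bounded [z]. Beyond that
    range only a one-sided bound is used: the chord estimate a^p - v^p >= min(1, p) a^(p-1) (a - v)
    makes f decay like exp (- (min(1, p) / p) z), up to a small loss in the exponent. This beats the
    growth exp (z / 2) allowed to r^2 exactly when min(1, p) / p > 1/2, that is p < 2. The margin is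
    recorded as [8 c] and halved at each approximation. All estimates are quantitative in a small
    [d], with [Z = 2 / d], and hold for each solution whose [mu] exceeds a threshold depending only
    on p, f, c and d, so no limit problem has to be classified. Since -(r u')' = lambda r f(u), the
    first integral is the boundary value - u'(1) = M(1) / A, and r^2 A u'' = M - W turns bounds on
    [M] and [W] into C^2 convergence. *)

Ltac derive_from_context :=
  auto_derive;
  [ repeat split; try (eexists; eassumption); auto
  | repeat match goal with
    | H : is_derive _ ?x ?d |- context [Derive ?g ?x] =>
        replace (Derive g x) with d
          by (symmetry; apply is_derive_unique; exact H)
    end ].

(** * Monotonicity, one-sided derivatives and power functions *)

(** Differentiability is asked only in the open interval because the phase plane equations divide by
    [r] and the equation holds two-sidedly only inside (0, 1). Almost every estimate below is an
    instance with a suitable auxiliary function. *)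
Lemma le_of_derive_nonneg (g : R -> R) (a b : R) :
  a <= b ->
  (forall x, a < x < b -> exists d, is_derive g x d /\ 0 <= d) ->
  (forall x, a <= x <= b -> continuity_pt g x) ->
  g a <= g b.
Proof.
intros ab Hd Hc.
(* [MVT_gen] locates its point only in the closed interval; the value 0 at the endpoints, where [g]
   may fail to be differentiable, keeps the sign there. *)
destruct (MVT_gen g a b (fun x => if Rlt_dec a x then
  if Rlt_dec x b then Derive g x else 0 else 0)) as [c [_ Hc']].
- rewrite Rmin_left, Rmax_right by lra.
  intros x Hx; destruct (Rlt_dec a x); [|lra].
  destruct (Rlt_dec x b); [|lra].
  destruct (Hd x Hx) as [d [D _]]; now rewrite (is_derive_unique _ _ _ D).
- now rewrite Rmin_left, Rmax_right by lra.
- assert (0 <= if Rlt_dec a c then if Rlt_dec c b then Derive g c else 0 else 0).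
  { destruct (Rlt_dec a c); [|lra]. destruct (Rlt_dec c b); [|lra].
    destruct (Hd c) as [d [D Hd0]]; [lra|]; now rewrite (is_derive_unique _ _ _ D). }
  nra.
Qed.

Lemma is_derive_continuity_pt (g : R -> R) (x d : R) :
  is_derive g x d -> continuity_pt g x.
Proof.
intros H; apply derivable_continuous_pt; exists d; now apply is_derive_Reals.
Qed.

(** A 1-Lipschitz map into [D] converts relative continuity into continuity on the whole line. It
    serves with [Rabs] for the half-line and with [clamp] for [0, 1]. *)
Lemma continuous_on_retraction (D : R -> Prop) (g rho : R -> R) :
  (forall x, D (rho x)) ->
  (forall x y, Rabs (rho x - rho y) <= Rabs (x - y)) ->
  Defs.continuous_on D g ->
  forall x, continuity_pt (fun y => g (rho y)) x.
Proof.
intros HD Hl Hg x eps Heps.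
destruct (Hg (rho x) (HD x) eps Heps) as [a [Ha H]].
exists a; split; [exact Ha|].
intros y [_ Hy]; simpl in *; unfold Rdist in *.
destruct (Req_dec (rho y) (rho x)) as [E|N].
- rewrite E, Rminus_diag, Rabs_R0; exact Heps.
- apply H; split; [split; [apply HD|congruence]|].
  eapply Rle_lt_trans; [apply Hl|exact Hy].
Qed.

Lemma derivative_on_is_derive (D : R -> Prop) (g g' : R -> R) (x r : R) :
  derivative_on D g g' -> 0 < r ->
  (forall y, Rabs (y - x) < r -> D y) ->
  is_derive g x (g' x).
Proof.
intros Hg Hr HD.
apply is_derive_Reals; intros eps Heps.
destruct (Hg x) with (eps := eps) as [a [Ha H]]; auto.
{ apply HD; rewrite Rminus_diag, Rabs_R0; exact Hr. }
assert (Hm : 0 < Rmin a r) by (apply Rmin_pos; lra).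
exists (mkposreal _ Hm); intros k Hk Hk'; simpl in Hk'.
specialize (H (x + k)); simpl in H; unfold Rdist in H.
replace (x + k - x) with k in H by ring.
apply H; split.
- split; [apply HD|lra]. replace (x + k - x) with k by ring.
  eapply Rlt_le_trans; [exact Hk'|apply Rmin_r].
- eapply Rlt_le_trans; [exact Hk'|apply Rmin_l].
Qed.

Lemma Rpower_succ (t q : R) : 0 < t -> Rpower t q = t * Rpower t (q - 1).
Proof.
intros Ht; rewrite <- (Rpower_1 t) at 2 by exact Ht.
rewrite <- Rpower_plus; f_equal; ring.
Qed.

Lemma is_derive_Rpower (q t : R) :
  0 < t -> is_derive (fun s => Rpower s q) t (q * Rpower t (q - 1)).
Proof. intros Ht; apply is_derive_Reals, derivable_pt_lim_power, Ht. Qed.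

Lemma rpow_pos (t q : R) : 0 < t -> rpow t q = Rpower t q.
Proof. intros Ht; unfold rpow; destruct (Rlt_dec 0 t); [reflexivity|lra]. Qed.

Lemma rpow_0 (q : R) : rpow 0 q = 0.
Proof. unfold rpow; destruct (Rlt_dec 0 0); [lra|reflexivity]. Qed.

Lemma rpow_nonneg (t q : R) : 0 <= rpow t q.
Proof.
unfold rpow; destruct (Rlt_dec 0 t); [left; apply exp_pos|lra].
Qed.

Lemma rpow_le (q s t : R) : 0 <= q -> 0 <= s <= t -> rpow s q <= rpow t q.
Proof.
intros Hq Hst; destruct (Rle_lt_or_eq_dec 0 s) as [Hs|<-]; [lra| |].
- rewrite !rpow_pos by lra; apply Rle_Rpower_l; lra.
- rewrite rpow_0; apply rpow_nonneg.
Qed.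

(** For q >= 1, v^(q-1) <= a^(q-1) bounds the secant slope below by a^(q-1); for q < 1, concavity
    bounds it below by the tangent slope q a^(q-1) at [a]. *)
Lemma rpow_chord (q v a : R) : 0 < q -> 0 <= v <= a -> 0 < a ->
  Rmin 1 q * Rpower a (q - 1) * (a - v) <= rpow a q - rpow v q.
Proof.
intros Hq Hv Ha.
assert (HA := exp_pos ((q - 1) * ln a)); fold (Rpower a (q - 1)) in HA.
rewrite (rpow_pos a q Ha), (Rpower_succ a q Ha).
destruct (Rle_lt_or_eq_dec 0 v) as [Hv0|<-]; [lra| |].
2:{ rewrite rpow_0. assert (H := Rmin_l 1 q).
    assert (0 < a * Rpower a (q - 1)) by nra. nra. }
rewrite (rpow_pos v q Hv0).
destruct (Rle_lt_dec 1 q) as [H1|H1].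
- rewrite Rmin_left by lra. rewrite (Rpower_succ v q Hv0).
  assert (Rpower v (q - 1) <= Rpower a (q - 1)) by (apply Rle_Rpower_l; lra).
  nra.
- rewrite Rmin_right by lra.
  set (G := fun t : R => Rpower t q - q * Rpower a (q - 1) * t).
  assert (H : G v <= G a).
  { assert (D : forall x, 0 < x -> is_derive
      (fun t => Rpower t q - q * Rpower a (q - 1) * t) x
      (q * Rpower x (q - 1) - q * Rpower a (q - 1))).
    { intros x Hx. assert (E := is_derive_Rpower q x Hx).
      derive_from_context; ring. }
    apply le_of_derive_nonneg; [lra| |].
    - intros x Hx; eexists; split; [apply D; lra|].
      assert (Rpower a (q - 1) <= Rpower x (q - 1)).
      { replace (q - 1) with (- (1 - q)) by ring. rewrite !Rpower_Ropp.
        apply Rinv_le_contravar; [apply exp_pos|apply Rle_Rpower_l; lra]. }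
      nra.
    - intros x Hx; eapply is_derive_continuity_pt, D; lra. }
  unfold G in H. rewrite (Rpower_succ a q Ha) in H. nra.
Qed.

(** Homogeneity reduces the claim to continuity of x^q at x = 1, which is why [s] does not depend on
    [a]. *)
Lemma Rpower_div_near_1 (q d : R) : 0 < d -> exists s, 0 < s < 1 /\
  forall a v, 0 < a -> (1 - s) * a <= v <= a ->
  (1 - d) * Rpower a q <= Rpower v q <= (1 + d) * Rpower a q.
Proof.
intros Hd.
assert (C : continuity_pt (fun x => Rpower x q) 1).
{ eapply is_derive_continuity_pt, is_derive_Rpower; lra. }
destruct (C d Hd) as [e [He H]].
assert (Hs : 0 < Rmin (e / 2) (1 / 2)) by (apply Rmin_pos; lra).
exists (Rmin (e / 2) (1 / 2)); split.
{ assert (G := Rmin_r (e / 2) (1 / 2)); lra. }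
intros a v Ha Hv.
assert (H1 := Rmin_l (e / 2) (1 / 2)); assert (H2 := Rmin_r (e / 2) (1 / 2)).
set (s := Rmin (e / 2) (1 / 2)) in *.
assert (Hx : 1 - s <= v / a <= 1).
{ split; apply (Rmult_le_reg_r a); try lra; field_simplify; lra. }
replace v with (v / a * a) by (field; lra).
rewrite <- Rpower_mult_distr by lra.
assert (HA := exp_pos (q * ln a)); fold (Rpower a q) in HA.
assert (Rabs (Rpower (v / a) q - 1) < d).
{ destruct (Req_dec (v / a) 1) as [E|N].
  - rewrite E. unfold Rpower; rewrite ln_1, Rmult_0_r, exp_0, Rminus_diag, Rabs_R0; lra.
  - assert (G : Rpower 1 q = 1) by (unfold Rpower; rewrite ln_1, Rmult_0_r, exp_0; ring).
    rewrite <- G. apply (H (v / a)); split; [split; [exact I|congruence]|].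
    simpl; unfold Rdist. apply Rabs_def1; lra. }
apply Rabs_def2 in H0. split; apply Rmult_le_compat_r; lra.
Qed.

Lemma exp_le (x y : R) : x <= y -> exp x <= exp y.
Proof. intros [H| ->]; [left; now apply exp_increasing|right; reflexivity]. Qed.

(** * Growth of the nonlinearity *)

(** This says f'/f ~ p t^(p-1), with [G] standing for f'/f. It is the only form in which the
    hypothesis on h' is used; at small arguments an upper bound on f suffices. *)
Definition asymptotic_log_derivative (p : R) (f : R -> R) : Prop :=
  forall eps, 0 < eps -> exists T, 0 < T /\ forall t, T <= t ->
    0 < f t /\ exists G, is_derive f t (f t * G) /\
    (1 - eps) * (p * Rpower t (p - 1)) <= G <= (1 + eps) * (p * Rpower t (p - 1)).

Definition locally_bounded_above (f : R -> R) : Prop :=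
  forall T, exists C, forall v, 0 <= v <= T -> f v <= C.

(** Here f'/f = p t^(p-1) + h'/h, and the hypothesis says that h'/h = o(t^(p-1)). The tolerance
    [eps * p] below is [eps] relative to p t^(p-1). *)
Lemma exp_nonlinearity_log_derivative (p : R) (h : R -> R) : 0 < p ->
  C1_on (fun t => 0 <= t) h ->
  (exists t0, 0 < t0 /\ forall t, t0 <= t -> 0 < h t) ->
  is_lim (fun t => Derive h t / (Rpower t (p - 1) * h t)) p_infty 0 ->
  asymptotic_log_derivative p (exp_nonlinearity p h).
Proof.
intros Hp [h' [Hh' _]] [t0 [Ht0 Hpos]] Hlim eps Heps.
apply is_lim_spec in Hlim.
assert (He : 0 < eps * p) by nra.
destruct (Hlim (mkposreal _ He)) as [M HM]; simpl in HM.
set (T := Rmax t0 (M + 1)).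
assert (HT0 : t0 <= T) by apply Rmax_l. assert (HT1 : M + 1 <= T) by apply Rmax_r.
exists T; split; [lra|]; intros t Ht.
assert (ht : 0 < h t) by (apply Hpos; lra).
assert (E : exp_nonlinearity p h t = h t * exp (Rpower t p))
  by (unfold exp_nonlinearity; rewrite rpow_pos by lra; reflexivity).
assert (HR := exp_pos ((p - 1) * ln t)); fold (Rpower t (p - 1)) in HR.
rewrite E; split; [apply Rmult_lt_0_compat; [exact ht|apply exp_pos]|].
assert (Dh : is_derive h t (h' t)).
{ apply (derivative_on_is_derive (fun t => 0 <= t) h h' t t Hh'); [lra|].
  intros y Hy; apply Rabs_def2 in Hy; lra. }
assert (Dp := is_derive_Rpower p t ltac:(lra)).
exists (p * Rpower t (p - 1) + h' t / h t); split.
- apply is_derive_ext_loc with (fun t => h t * exp (Rpower t p)).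
  + exists (mkposreal t ltac:(lra)); intros y Hy.
    unfold exp_nonlinearity; rewrite rpow_pos; [reflexivity|].
    apply Rabs_def2 in Hy; simpl in Hy; unfold minus, plus, opp in Hy; simpl in Hy; lra.
  + derive_from_context; field; lra.
- specialize (HM t ltac:(lra)). rewrite (is_derive_unique _ _ _ Dh), Rminus_0_r in HM.
  apply Rabs_def2 in HM.
  assert (E2 : h' t / h t = h' t / (Rpower t (p - 1) * h t) * Rpower t (p - 1))
    by (field; split; lra).
  rewrite E2; split; nra.
Qed.

Lemma exp_nonlinearity_locally_bounded (p : R) (h : R -> R) : 0 < p ->
  (forall t, 0 <= t -> 0 <= h t) -> C1_on (fun t => 0 <= t) h ->
  locally_bounded_above (exp_nonlinearity p h).
Proof.
intros Hp H0 [h' [Hh' _]] T.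
destruct (Rle_lt_dec 0 T) as [HT|HT].
2:{ exists 0; intros v Hv; lra. }
destruct (continuity_ab_maj (fun t => h (Rabs t)) 0 T HT) as [m [Hm _]].
{ intros c _; apply (continuous_on_retraction (fun t => 0 <= t)).
  - apply Rabs_pos.
  - apply Rabs_triang_inv2.
  - intros x Hx; apply cont_deriv with h'; now apply Hh'. }
exists (h (Rabs m) * exp (rpow T p)); intros v Hv.
unfold exp_nonlinearity.
apply Rmult_le_compat; [apply H0; lra|left; apply exp_pos| |].
- rewrite <- (Rabs_pos_eq v) by lra; now apply Hm.
- apply exp_le; apply rpow_le; lra.
Qed.

(** The logarithmic derivative of f(t) exp (- k t^p) is G - k p t^(p-1), which is nonnegative for k
    = 1 - eps and nonpositive for k = 1 + eps. *)
Lemma growth_bounds (p : R) (f : R -> R) (eps : R) : 0 < p -> 0 < eps ->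
  asymptotic_log_derivative p f ->
  exists T, 0 < T /\ (forall t, T <= t -> 0 < f t) /\ forall v a, T <= v <= a ->
    f v * exp ((1 - eps) * (Rpower a p - Rpower v p)) <= f a <=
    f v * exp ((1 + eps) * (Rpower a p - Rpower v p)).
Proof.
intros Hp Heps Hf; destruct (Hf eps Heps) as [T [HT H]].
exists T; split; [exact HT|]; split; [intros t Ht; apply (H t Ht)|].
intros v a Hva.
assert (HR : forall t, 0 < p * Rpower t (p - 1)).
{ intros t; apply Rmult_lt_0_compat; [exact Hp|apply exp_pos]. }
assert (D : forall k t G, T <= t -> is_derive f t (f t * G) ->
  is_derive (fun s => f s * exp (- k * Rpower s p)) t
  (f t * exp (- k * Rpower t p) * (G - k * (p * Rpower t (p - 1))))).
{ intros k t G Ht DG; assert (Dp := is_derive_Rpower p t ltac:(lra)).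
  derive_from_context; ring. }
assert (S : forall k, f v * exp (k * (Rpower a p - Rpower v p)) =
   exp (k * Rpower a p) * (f v * exp (- k * Rpower v p))).
{ intros k. replace (k * (Rpower a p - Rpower v p)) with
    (k * Rpower a p + - k * Rpower v p) by ring. rewrite exp_plus; ring. }
assert (S' : forall k, f a = exp (k * Rpower a p) * (f a * exp (- k * Rpower a p))).
{ intros k. replace (- k * Rpower a p) with (- (k * Rpower a p)) by ring.
  rewrite exp_Ropp; field; apply Rgt_not_eq, exp_pos. }
assert (C : forall k x, v <= x <= a -> continuity_pt (fun s => f s * exp (- k * Rpower s p)) x).
{ intros k x Hx; destruct (H x) as [_ [G [DG _]]]; [lra|].
  eapply is_derive_continuity_pt, (D k x G); [lra|exact DG]. }
split.
- rewrite S, (S' (1 - eps)) at 1.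
  apply Rmult_le_compat_l; [left; apply exp_pos|].
  apply (le_of_derive_nonneg (fun s => f s * exp (- (1 - eps) * Rpower s p))); [lra| |apply C].
  intros x Hx; destruct (H x) as [fx [G [DG HG]]]; [lra|].
  eexists; split; [apply D; [lra|exact DG]|].
  apply Rmult_le_pos; [|lra]. apply Rmult_le_pos; [lra|left; apply exp_pos].
- rewrite S, (S' (1 + eps)) at 1.
  apply Rmult_le_compat_l; [left; apply exp_pos|].
  apply Ropp_le_cancel.
  apply (le_of_derive_nonneg (fun s => - (f s * exp (- (1 + eps) * Rpower s p)))); [lra| |].
  + intros x Hx; destruct (H x) as [fx [G [DG HG]]]; [lra|].
    eexists; split; [apply (is_derive_opp (fun s => f s * exp (- (1 + eps) * Rpower s p))), D; [lra|exact DG]|].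
    unfold opp; simpl. rewrite <- Ropp_mult_distr_r_reverse.
    apply Rmult_le_pos; [|lra]. apply Rmult_le_pos; [lra|left; apply exp_pos].
  + intros x Hx; apply continuity_pt_opp, C, Hx.
Qed.

Lemma Rpower_large (p B : R) : 0 < p -> exists M, 0 < M /\ forall a, M <= a -> B <= Rpower a p.
Proof.
intros Hp; assert (HB : 0 < Rmax B 1) by (eapply Rlt_le_trans; [apply Rlt_0_1|apply Rmax_r]).
exists (Rpower (Rmax B 1) (/ p)); split; [apply exp_pos|]; intros a Ha.
apply Rle_trans with (Rpower (Rpower (Rmax B 1) (/ p)) p).
- rewrite Rpower_mult, Rinv_l, Rpower_1 by lra; apply Rmax_l.
- apply Rle_Rpower_l; [lra|split; [apply exp_pos|exact Ha]].
Qed.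

(** Far out, [growth_bounds] gives the larger rate (1 + k) / 2. Lowering it to [k] leaves a surplus
    (1 - k) / 2 * a^p in the exponent, and this absorbs the unknown values of f at small [v], where
    only an upper bound is known. *)
Lemma global_growth_bound (p : R) (f : R -> R) (k : R) : 0 < p -> 0 <= k < 1 ->
  (forall t, 0 <= t -> 0 <= f t) ->
  locally_bounded_above f -> asymptotic_log_derivative p f ->
  exists T, 0 < T /\ forall v a, T <= a -> 0 <= v <= a ->
    f v <= f a * exp (- k * (rpow a p - rpow v p)).
Proof.
intros Hp Hk f0 Hb Hf.
destruct (growth_bounds p f ((1 - k) / 2) Hp ltac:(lra) Hf) as [T [HT [fp HG]]].
destruct (Hb T) as [C HC].
assert (fT := fp T (Rle_refl T)).
(* For such [a] the surplus is at least C / f T plus the loss from T^p, so 1 + X <= exp X is enough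
   to dominate the bound [C]. *)
destruct (Rpower_large p (2 / (1 - k) * (Rabs (C / f T) + (1 - (1 - k) / 2) * Rpower T p)) Hp)
  as [M [HM HM']].
exists (Rmax T M); split; [eapply Rlt_le_trans; [exact HT|apply Rmax_l]|].
intros v a Ha Hv.
assert (HTa : T <= a) by (eapply Rle_trans; [apply Rmax_l|exact Ha]).
assert (HMa : M <= a) by (eapply Rle_trans; [apply Rmax_r|exact Ha]).
rewrite (rpow_pos a) by lra.
assert (S : forall x y, exp (- x * y) * exp (x * y) = 1).
{ intros x y; rewrite <- exp_plus; replace (- x * y + x * y) with 0 by ring; apply exp_0. }
destruct (Rle_lt_dec T v) as [HTv|HTv].
- rewrite rpow_pos by lra.
  destruct (HG v a ltac:(lra)) as [G _].
  assert (MV : Rpower v p <= Rpower a p) by (apply Rle_Rpower_l; lra).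
  assert (fv := fp v HTv).
  apply Rle_trans with (f v * exp ((1 - (1 - k) / 2) * (Rpower a p - Rpower v p))
     * exp (- k * (Rpower a p - Rpower v p))).
  2:{ apply Rmult_le_compat_r; [left; apply exp_pos|exact G]. }
  rewrite Rmult_assoc, <- exp_plus, <- (Rmult_1_r (f v)) at 1.
  apply Rmult_le_compat_l; [lra|].
  rewrite <- exp_0 at 1; apply exp_le. nra.
- destruct (HG T a ltac:(lra)) as [G _].
  specialize (HM' a HMa).
  apply Rle_trans with C; [apply HC; lra|].
  assert (HV := rpow_nonneg v p).
  apply Rle_trans with (f T * exp ((1 - (1 - k) / 2) * (Rpower a p - Rpower T p))
     * exp (- k * (Rpower a p - rpow v p))).
  2:{ apply Rmult_le_compat_r; [left; apply exp_pos|exact G]. }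
  rewrite Rmult_assoc, <- exp_plus.
  apply Rle_trans with (f T * (C / f T)); [right; field; lra|].
  apply Rmult_le_compat_l; [lra|].
  eapply Rle_trans; [apply Rle_abs|].
  set (X := _ + _) in |- *.
  apply Rle_trans with (1 + X); [|apply exp_ineq1_le].
  assert (2 / (1 - k) * (Rabs (C / f T) + (1 - (1 - k) / 2) * Rpower T p) * ((1 - k) / 2)
    <= Rpower a p * ((1 - k) / 2)) by (apply Rmult_le_compat_r; lra).
  replace (2 / (1 - k) * (Rabs (C / f T) + (1 - (1 - k) / 2) * Rpower T p) * ((1 - k) / 2))
   with (Rabs (C / f T) + (1 - (1 - k) / 2) * Rpower T p) in H by (field; lra).
  unfold X; nra.
Qed.

(** * The phase plane system *)

Lemma radial_mass_increasing (M W : R -> R) :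
  (forall r, 0 < r < 1 -> is_derive M r (W r / r)) ->
  (forall r, continuity_pt M r) ->
  (forall r, 0 <= r <= 1 -> 0 <= W r) ->
  forall r s, 0 <= r -> r <= s -> s <= 1 -> M r <= M s.
Proof.
intros DM CM W0 r s Hr Hrs Hs.
apply le_of_derive_nonneg; [exact Hrs| |auto].
intros x Hx; eexists; split; [apply DM; lra|].
apply Rmult_le_pos; [apply W0; lra|left; apply Rinv_0_lt_compat; lra].
Qed.

(* With constant [g] the quantity [W - 2 M + g M^2 / 2] is a first integral of
   [r M' = W], [r W' = W (2 - g M)]. *)
Lemma energy_bounds (M W : R -> R) (r0 d : R) : 0 < r0 < 1 ->
  (forall r, 0 < r < 1 -> is_derive M r (W r / r)) ->
  (forall r, continuity_pt M r) -> (forall r, continuity_pt W r) ->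
  (forall r, 0 <= r <= 1 -> 0 <= W r) ->
  (forall r, 0 < r < r0 -> exists g, 1 - d <= g <= 1 + d /\
     is_derive W r (W r * (2 - g * M r) / r)) ->
  M 0 = 0 -> W 0 = 0 ->
  forall r, 0 <= r <= r0 ->
  2 * M r - (1 + d) * (M r)^2 / 2 <= W r <= 2 * M r - (1 - d) * (M r)^2 / 2.
Proof.
intros Hr0 DM CM CW W0 DW M00 W00 r Hr.
assert (M0 : forall s, 0 <= s <= 1 -> 0 <= M s).
{ intros s Hs; rewrite <- M00; apply (radial_mass_increasing M W); auto; lra. }
(* The factor k - g fixes the sign: the energy with k = 1 + d is nondecreasing, the one with k = 1 -
   d is nonincreasing, and both vanish at 0. *)
assert (D : forall k g s, 0 < s < r0 -> is_derive W s (W s * (2 - g * M s) / s) ->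
  is_derive (fun s => W s - 2 * M s + k * (M s * M s) / 2) s (W s * M s * (k - g) / s)).
{ intros k g s Hs Dg; assert (DMs := DM s ltac:(lra)).
  derive_from_context; field; lra. }
assert (C : forall k s, continuity_pt (fun s => W s - 2 * M s + k * (M s * M s) / 2) s).
{ intros k s. apply continuity_pt_plus; [apply continuity_pt_minus|]; [apply CW| |].
  - apply continuity_pt_mult; [apply continuity_pt_const; now intros ? ?|apply CM].
  - apply continuity_pt_mult; [|apply continuity_pt_const; now intros ? ?].
    apply continuity_pt_mult; [apply continuity_pt_const; now intros ? ?|].
    apply continuity_pt_mult; apply CM. }
assert (P : forall s, 0 < s < r0 -> 0 <= W s * M s / s).
{ intros s Hs; apply Rmult_le_pos; [|left; apply Rinv_0_lt_compat; lra].
  apply Rmult_le_pos; [apply W0; lra|apply M0; lra]. }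
split.
- set (G := fun s : R => W s - 2 * M s + (1 + d) * (M s * M s) / 2).
  assert (H : G 0 <= G r).
  { apply le_of_derive_nonneg; [lra| |intros; apply C].
    intros x Hx; destruct (DW x) as [g [Hg Dg]]; [lra|].
    eexists; split; [apply (D (1 + d) g); [lra|exact Dg]|].
    replace (W x * M x * (1 + d - g) / x) with (W x * M x / x * (1 + d - g)) by (field; lra).
    apply Rmult_le_pos; [apply P; lra|lra]. }
  unfold G in H; rewrite M00, W00 in H; nra.
- set (G := fun s : R => - (W s - 2 * M s + (1 - d) * (M s * M s) / 2)).
  assert (H : G 0 <= G r).
  { apply le_of_derive_nonneg;
      [lra| |intros; apply continuity_pt_opp, C].
    intros x Hx; destruct (DW x) as [g [Hg Dg]]; [lra|].
    eexists; split.
    { apply (is_derive_opp (fun s => W s - 2 * M s + (1 - d) * (M s * M s) / 2)), (D (1 - d) g);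
      [lra|exact Dg]. }
    unfold opp; simpl.
    replace (- (W x * M x * (1 - d - g) / x)) with (W x * M x / x * (g - (1 - d))) by (field; lra).
    apply Rmult_le_pos; [apply P; lra|lra]. }
  unfold G in H; rewrite M00, W00 in H; nra.
Qed.

(* If [M] stayed below [4 (1 - d) / (1 + d)] then [W >= 2 d M], hence
   [M >= 2 d z], which contradicts [z r0 >= 2 / d]. *)
Lemma bubble_mass (z M W : R -> R) (r0 d : R) : 0 < r0 < 1 -> 0 < d <= 1 / 8 ->
  (forall r, 0 < r < 1 -> is_derive z r (M r / r)) ->
  (forall r, 0 < r < 1 -> is_derive M r (W r / r)) ->
  (forall r, continuity_pt z r) ->
  (forall r, continuity_pt M r) -> (forall r, continuity_pt W r) ->
  (forall r, 0 <= r <= 1 -> 0 <= W r) ->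
  (forall r, 0 < r < r0 -> exists g, 1 - d <= g <= 1 + d /\
     is_derive W r (W r * (2 - g * M r) / r)) ->
  z 0 = 0 -> M 0 = 0 -> W 0 = 0 -> 2 / d <= z r0 ->
  4 - 8 * d <= M r0 <= 4 + 8 * d /\ W r0 <= 6 * d * M r0.
Proof.
intros Hr0 Hd Dz DM Cz CM CW W0 DW z00 M00 W00 Hz.
assert (E := energy_bounds M W r0 d Hr0 DM CM CW W0 DW M00 W00).
assert (Minc := radial_mass_increasing M W DM CM W0).
assert (M0 : forall s, 0 <= s <= 1 -> 0 <= M s).
{ intros s Hs; rewrite <- M00; apply Minc; lra. }
assert (L : 4 * (1 - d) <= (1 + d) * M r0).
{ destruct (Rle_lt_dec (4 * (1 - d)) ((1 + d) * M r0)) as [|N]; [assumption|exfalso].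
  set (G := fun s : R => M s - 2 * d * z s).
  assert (H : G 0 <= G r0).
  { apply le_of_derive_nonneg; [lra| |].
    - intros x Hx; assert (Dzx := Dz x ltac:(lra)); assert (DMx := DM x ltac:(lra)).
      exists (W x / x - 2 * d * (M x / x)); split; [unfold G; derive_from_context; ring|].
      replace (W x / x - 2 * d * (M x / x)) with ((W x - 2 * d * M x) / x) by (field; lra).
      apply Rmult_le_pos; [|left; apply Rinv_0_lt_compat; lra].
      destruct (E x ltac:(lra)) as [E1 _].
      assert (Hx1 := Minc x r0 ltac:(lra) ltac:(lra) ltac:(lra)).
      assert (Hx0 := M0 x ltac:(lra)).
      assert ((1 + d) * M x <= 4 * (1 - d)) by nra. nra.
    - intros x Hx; apply continuity_pt_minus; [apply CM|].
      apply continuity_pt_mult; [apply continuity_pt_const; now intros ? ?|apply Cz]. }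
  unfold G in H; rewrite z00, M00 in H.
  assert (d * (2 / d) <= d * z r0) by (apply Rmult_le_compat_l; lra).
  replace (d * (2 / d)) with 2 in H0 by (field; lra). nra. }
destruct (E r0 ltac:(lra)) as [_ E2].
assert (HW := W0 r0 ltac:(lra)). assert (HM := M0 r0 ltac:(lra)).
assert (L1 : 4 - 8 * d <= M r0) by nra.
assert (U : (1 - d) * M r0 <= 4) by nra.
repeat split; [lra|nra|].
(* In W <= M (2 - (1 - d) M / 2) the bracket is at most 2 - 2 (1 - d)^2 / (1 + d), hence at most 6
   d. *)
assert (4 * ((1 - d) * (1 - d)) <= (1 + d) * ((1 - d) * M r0)) by nra.
assert (2 - (1 - d) * M r0 / 2 <= 6 * d) by nra.
nra.
Qed.

(* Past [r0] the variable [z] grows at least like [M r0 * ln r], so the factor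
   [r^2] in [W] costs at most [exp (2 z / M r0)], about [exp (z / 2)]. *)
Lemma tail_mass (z M W : R -> R) (r0 c K : R) : 0 < r0 < 1 -> 0 < c ->
  (forall r, 0 < r < 1 -> is_derive z r (M r / r)) ->
  (forall r, 0 < r < 1 -> is_derive M r (W r / r)) ->
  (forall r, continuity_pt z r) ->
  (forall r, continuity_pt M r) ->
  (forall r, 0 <= r <= 1 -> 0 <= W r) ->
  (forall r, r0 <= r <= 1 ->
     W r <= W r0 * (r / r0)^2 * exp (- K * (z r - z r0))) ->
  0 < M r0 -> 2 / M r0 + c <= K ->
  forall r, r0 <= r <= 1 -> M r <= M r0 + W r0 / (c * M r0) /\ W r <= W r0.
Proof.
intros Hr0 Hc Dz DM Cz CM W0 HW Mpos HK.
assert (Minc := radial_mass_increasing M W DM CM W0).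
assert (zlog : forall r, r0 <= r <= 1 -> M r0 * ln (r / r0) <= z r - z r0).
{ intros r Hr.
  set (G := fun s : R => z s - M r0 * ln (s / r0)).
  assert (H : G r0 <= G r).
  { assert (Dl : forall x, r0 <= x -> is_derive (fun s => ln (s / r0)) x (/ x)).
    { intros x Hx; auto_derive; [|field; lra].
      apply Rmult_lt_0_compat; [lra|apply Rinv_0_lt_compat; lra]. }
    apply le_of_derive_nonneg; [lra| |].
    - intros x Hx; assert (Dzx := Dz x ltac:(lra)); assert (Dlx := Dl x ltac:(lra)).
      exists (M x / x - M r0 * / x); split.
      + apply (is_derive_minus (K := R_AbsRing) z (fun s => M r0 * ln (s / r0))); [exact Dzx|].
        apply (is_derive_scal (fun s => ln (s / r0)) x); exact Dlx.
      + replace (M x / x - M r0 * / x) with ((M x - M r0) / x) by (field; lra).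
        apply Rmult_le_pos; [|left; apply Rinv_0_lt_compat; lra].
        assert (M r0 <= M x) by (apply Minc; lra). lra.
    - intros x Hx; apply continuity_pt_minus; [apply Cz|].
      apply continuity_pt_mult; [apply continuity_pt_const; now intros ? ?|].
      eapply is_derive_continuity_pt, Dl; lra. }
  unfold G in H. replace (r0 / r0) with 1 in H by (field; lra). rewrite ln_1 in H. lra. }
assert (Wexp : forall r, r0 <= r <= 1 -> W r <= W r0 * exp (- c * (z r - z r0))).
{ intros r Hr; eapply Rle_trans; [apply HW, Hr|].
  rewrite Rmult_assoc; apply Rmult_le_compat_l; [apply W0; lra|].
  assert (Hq : 0 < r / r0) by (apply Rmult_lt_0_compat; [lra|apply Rinv_0_lt_compat; lra]).
  rewrite <- (exp_ln (r / r0)) at 1 by exact Hq.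
  simpl; rewrite Rmult_1_r, <- !exp_plus; apply exp_le.
  assert (Hl := zlog r Hr).
  assert (0 <= ln (r / r0)).
  { rewrite <- ln_1; apply ln_le; [lra|].
    apply (Rmult_le_reg_r r0); [lra|]; field_simplify; lra. }
  assert (ln (r / r0) <= (z r - z r0) / M r0).
  { apply (Rmult_le_reg_r (M r0)); [lra|]; field_simplify; lra. }
  assert (0 <= z r - z r0) by nra.
  assert ((2 / M r0 + c) * (z r - z r0) <= K * (z r - z r0)) by (apply Rmult_le_compat_r; lra).
  replace ((2 / M r0 + c) * (z r - z r0)) with (2 * ((z r - z r0) / M r0) + c * (z r - z r0)) in H2
    by (field; lra).
  lra. }
assert (HW0 := W0 r0 ltac:(lra)).
assert (Hcm : 0 < c * M r0) by nra.
intros r Hr; split.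
(* The added term is a potential for the mass still to come: by r z' = M >= M r0 it decreases at
   least as fast as [Wexp] lets M increase. Its value at [r0] is the bound on the total gain. *)
- set (G := fun s : R => - (M s + W r0 / (c * M r0) * exp (- c * (z s - z r0)))).
  assert (H : G r0 <= G r).
  { assert (D : forall x, r0 < x < 1 -> is_derive
      (fun s => - (M s + W r0 / (c * M r0) * exp (- c * (z s - z r0)))) x
      ((W r0 * exp (- c * (z x - z r0)) * (M x / M r0) - W x) / x)).
    { intros x Hx; assert (Dzx := Dz x ltac:(lra)); assert (DMx := DM x ltac:(lra)).
      derive_from_context. fold (z x - z r0); field; lra. }
    apply le_of_derive_nonneg;
      [lra| |].
    - intros x Hx; eexists; split; [apply D; lra|].
      apply Rmult_le_pos; [|left; apply Rinv_0_lt_compat; lra].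
      assert (Hw := Wexp x ltac:(lra)).
      assert (M r0 <= M x) by (apply Minc; lra).
      assert (1 <= M x / M r0) by (apply (Rmult_le_reg_r (M r0)); [lra|]; field_simplify; lra).
      assert (He := exp_pos (- c * (z x - z r0))).
      assert (0 <= W r0 * exp (- c * (z x - z r0))) by nra. nra.
    - intros x Hx; apply continuity_pt_opp, continuity_pt_plus; [apply CM|].
      apply continuity_pt_mult; [apply continuity_pt_const; now intros ? ?|].
      apply (continuity_pt_comp (fun s => - c * (z s - z r0)) exp).
      + apply continuity_pt_mult; [apply continuity_pt_const; now intros ? ?|].
        apply continuity_pt_minus; [apply Cz|apply continuity_pt_const; now intros ? ?].
      + apply derivable_continuous_pt, derivable_pt_exp. }
  unfold G in H. replace (- c * (z r0 - z r0)) with 0 in H by ring. rewrite exp_0 in H.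
  assert (0 <= W r0 / (c * M r0) * exp (- c * (z r - z r0))).
  { apply Rmult_le_pos; [|left; apply exp_pos].
    apply Rmult_le_pos; [lra|left; now apply Rinv_0_lt_compat]. }
  lra.
- eapply Rle_trans; [apply Wexp, Hr|].
  rewrite <- (Rmult_1_r (W r0)) at 2; apply Rmult_le_compat_l; [lra|].
  rewrite <- exp_0; apply exp_le.
  assert (Hl := zlog r Hr).
  assert (0 <= ln (r / r0)).
  { rewrite <- ln_1; apply ln_le; [lra|].
    apply (Rmult_le_reg_r r0); [lra|]; field_simplify; lra. }
  nra.
Qed.

(** The bubble gives 2 / M r0 <= 1/2 + 2 d <= 1/2 + c, so a decay rate 1/2 + 2 c leaves [c] for the
    tail. There the gain W r0 / (c * M r0) is at most 6 d / c, and 30 d comes from 6 d * M r0 with M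
    r0 <= 5. *)
Lemma phase_concentration (z M W : R -> R) (r0 d c K : R) :
  0 < r0 < 1 -> 0 < d <= 1 / 8 -> 2 * d <= c ->
  (forall r, 0 < r < 1 -> is_derive z r (M r / r)) ->
  (forall r, 0 < r < 1 -> is_derive M r (W r / r)) ->
  (forall r, continuity_pt z r) ->
  (forall r, continuity_pt M r) -> (forall r, continuity_pt W r) ->
  (forall r, 0 <= r <= 1 -> 0 <= W r) ->
  (forall r, 0 < r < r0 -> exists g, 1 - d <= g <= 1 + d /\
     is_derive W r (W r * (2 - g * M r) / r)) ->
  z 0 = 0 -> M 0 = 0 -> W 0 = 0 -> 2 / d <= z r0 ->
  (forall r, r0 <= r <= 1 ->
     W r <= W r0 * (r / r0)^2 * exp (- K * (z r - z r0))) ->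
  1 / 2 + 2 * c <= K ->
  forall r, r0 <= r <= 1 ->
  4 - 8 * d <= M r <= 4 + 8 * d + 6 * d / c /\ W r <= 30 * d.
Proof.
intros Hr0 Hd Hc Dz DM Cz CM CW W0 DW z00 M00 W00 Hz HW HK.
destruct (bubble_mass z M W r0 d) as [[L U] V]; auto.
assert (HK' : 2 / M r0 + c <= K).
{ assert (2 / M r0 <= 1 / 2 + 2 * d).
  { apply (Rmult_le_reg_r (M r0)); [lra|]. unfold Rdiv at 1.
    rewrite Rmult_assoc, Rinv_l by lra. nra. }
  lra. }
intros r Hr.
destruct (tail_mass z M W r0 c K Hr0 ltac:(lra) Dz DM Cz CM W0 HW ltac:(lra) HK' r Hr) as [T1 T2].
assert (M r0 <= M r) by (apply (radial_mass_increasing M W); auto; lra).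
assert (W r0 / (c * M r0) <= 6 * d / c).
{ apply (Rmult_le_reg_r (c * M r0)); [nra|]. field_simplify; [|lra|split; lra]. lra. }
repeat split; [lra|lra|nra].
Qed.

(** * Uniform estimates on f for large maximum values *)

Lemma ln_Rpower (x y : R) : ln (Rpower x y) = y * ln x.
Proof. unfold Rpower; apply ln_exp. Qed.

(** With y = a^p the logarithm is ln p + ((p - 1) / p) ln y, and ln y / y tends to 0. This makes ln
    A negligible against mu^p when lambda is recovered. *)
Lemma ln_power_small (p d : R) : 0 < p -> 0 < d -> exists M, 0 < M /\
  forall a, M <= a -> Rabs (ln (p * Rpower a (p - 1))) <= d * Rpower a p.
Proof.
intros Hp Hd.
assert (L := is_lim_div_ln_p); apply is_lim_spec in L.
set (q := Rabs (p - 1) / p).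
assert (Hq : 0 <= q) by (apply Rmult_le_pos; [apply Rabs_pos|left; apply Rinv_0_lt_compat; lra]).
assert (He : 0 < d / (2 * (q + 1))) by (apply Rmult_lt_0_compat; [lra|apply Rinv_0_lt_compat; lra]).
destruct (L (mkposreal _ He)) as [B HB]; simpl in HB.
destruct (Rpower_large p (Rmax (B + 1) (Rabs (ln p) * 2 / d)) Hp) as [M [HM H]].
exists M; split; [exact HM|]; intros a Ha.
specialize (H a Ha).
assert (Hy : B < Rpower a p).
{ assert (G := Rmax_l (B + 1) (Rabs (ln p) * 2 / d)); lra. }
assert (Hy2 : Rabs (ln p) <= d / 2 * Rpower a p).
{ apply Rle_trans with (d / 2 * (Rabs (ln p) * 2 / d)); [right; field; lra|].
  apply Rmult_le_compat_l; [lra|].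
  assert (G := Rmax_r (B + 1) (Rabs (ln p) * 2 / d)); lra. }
specialize (HB _ Hy). rewrite Rminus_0_r, ln_Rpower in HB.
assert (Y := exp_pos (p * ln a)); fold (Rpower a p) in Y.
rewrite ln_mult, ln_Rpower by (try apply exp_pos; lra).
eapply Rle_trans; [apply Rabs_triang|].
assert (Rabs ((p - 1) * ln a) <= d / 2 * Rpower a p); [|lra].
replace ((p - 1) * ln a) with ((p - 1) / p * (p * ln a / Rpower a p) * Rpower a p) by (field; lra).
rewrite !Rabs_mult, (Rabs_pos_eq (Rpower a p)) by lra.
apply Rmult_le_compat_r; [lra|].
replace (Rabs ((p - 1) / p)) with q.
2:{ unfold q, Rdiv; rewrite Rabs_mult, (Rabs_pos_eq (/ p)); [reflexivity|].
    left; apply Rinv_0_lt_compat; lra. }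
apply Rle_trans with (q * (d / (2 * (q + 1)))); [apply Rmult_le_compat_l; lra|].
apply Rle_trans with ((q + 1) * (d / (2 * (q + 1)))); [apply Rmult_le_compat_r; lra|].
right; field; lra.
Qed.

(** This collects everything needed from f once [mu] is large. The window for [a] is where z <= 2 /
    d; since A mu = p mu^p, its width relative to mu is of order mu^(-p), so powers of [a] and [mu]
    are interchangeable there. The bound on f v reaches down to v = 0, far outside the window. *)
Lemma growth_near_maximum (p : R) (f : R -> R) (c d : R) : 0 < p ->
  0 < c -> Rmin 1 p = (1 / 2 + 8 * c) * p -> 0 < d <= 1 / 8 -> 2 * d <= c ->
  (forall t, 0 <= t -> 0 <= f t) ->
  locally_bounded_above f -> asymptotic_log_derivative p f ->
  exists mu0, 0 < mu0 /\ forall mu, mu0 <= mu ->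
    let A := p * Rpower mu (p - 1) in
    Rabs (ln A) <= d * Rpower mu p /\ 2 / d <= d * Rpower mu p /\
    2 / d < p * Rpower mu p /\
    forall a, mu - 2 / d / A <= a <= mu ->
      0 < a /\ mu - a <= d * mu /\ 0 < f a /\
      (exists G, is_derive f a (f a * G) /\ (1 - d) * A <= G <= (1 + d) * A) /\
      (forall v, 0 <= v <= a -> f v <= f a * exp (- ((1 / 2 + 2 * c) * A) * (a - v))) /\
      (1 - d) * Rpower mu p <= ln (f a) <= (1 + d) * Rpower mu p.
Proof.
intros Hp Hc Hmin Hd Hdc f0 Hb Hf.
assert (Hc' : c <= 1 / 16) by (assert (G := Rmin_r 1 p); nra).
destruct (growth_bounds p f (d / 4) Hp ltac:(lra) Hf) as [T1 [HT1 [fpos HG1]]].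
destruct (Hf (d / 4) ltac:(lra)) as [T2 [HT2 HG2]].
(* Replacing rate 1 by k < 1 in the growth bound reduces the margin from 8 c to 4 c; passing from
   [a] to [mu] in A reduces it to 2 c. *)
set (k := (1 / 2 + 4 * c) / (1 / 2 + 8 * c)).
assert (Hk : k * (1 / 2 + 8 * c) = 1 / 2 + 4 * c) by (unfold k; field; lra).
destruct (global_growth_bound p f k Hp) as [T3 [HT3 HG3]]; [nra|assumption..|].
destruct (Rpower_div_near_1 (p - 1) (d / 4) ltac:(lra)) as [s1 [Hs1 HS1]].
destruct (Rpower_div_near_1 p (d / 4) ltac:(lra)) as [s2 [Hs2 HS2]].
destruct (ln_power_small p d Hp ltac:(lra)) as [M1 [HM1 HL1]].
(* [s1] and [s2] control the powers p - 1 and p, [d] gives mu - a <= d * mu, and 1 / 2 keeps [a]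
   above mu / 2, hence above the thresholds T1, T2 and T3. *)
set (s := Rmin (Rmin s1 s2) (Rmin d (1 / 2))).
assert (Hs : 0 < s) by (unfold s; repeat apply Rmin_pos; lra).
assert (S1 : s <= s1) by (eapply Rle_trans; [apply Rmin_l|apply Rmin_l]).
assert (S2 : s <= s2) by (eapply Rle_trans; [apply Rmin_l|apply Rmin_r]).
assert (S3 : s <= d) by (eapply Rle_trans; [apply Rmin_r|apply Rmin_l]).
assert (S4 : s <= 1 / 2) by (eapply Rle_trans; [apply Rmin_r|apply Rmin_r]).
(* Lower bounds for mu^p: [B1] makes 2 / d at most d * mu^p, [B2] makes the window narrower than s *
   mu, and [B3] absorbs ln (f T1) and T1^p into d / 4 * mu^p. *)
set (B1 := 2 / d / d). set (B2 := 2 / d / (p * s)).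
set (B3 := (Rabs (ln (f T1)) + 2 * Rpower T1 p) * (4 / d)).
destruct (Rpower_large p (Rmax (Rmax B1 B2) B3) Hp) as [M2 [HM2 HL2]].
set (mu0 := Rmax (Rmax M1 M2) (2 * Rmax T1 (Rmax T2 T3))).
assert (N1 : M1 <= mu0) by (eapply Rle_trans; [apply Rmax_l|apply Rmax_l]).
assert (N2 : M2 <= mu0) by (eapply Rle_trans; [apply Rmax_r|apply Rmax_l]).
assert (N3 : 2 * Rmax T1 (Rmax T2 T3) <= mu0) by apply Rmax_r.
assert (N4 : T1 <= Rmax T1 (Rmax T2 T3)) by apply Rmax_l.
assert (N5 : T2 <= Rmax T1 (Rmax T2 T3)) by (eapply Rle_trans; [apply Rmax_l|apply Rmax_r]).
assert (N6 : T3 <= Rmax T1 (Rmax T2 T3)) by (eapply Rle_trans; [apply Rmax_r|apply Rmax_r]).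
exists mu0; split; [lra|]; intros mu Hmu A.
specialize (HL2 mu ltac:(lra)).
assert (HB1 : B1 <= Rpower mu p).
{ eapply Rle_trans; [|exact HL2]; eapply Rle_trans; [apply Rmax_l|apply Rmax_l]. }
assert (HB2 : B2 <= Rpower mu p).
{ eapply Rle_trans; [|exact HL2]; eapply Rle_trans; [apply Rmax_r|apply Rmax_l]. }
assert (HB3 : B3 <= Rpower mu p) by (eapply Rle_trans; [|exact HL2]; apply Rmax_r).
clear HL2.
assert (Y := exp_pos ((p - 1) * ln mu)); fold (Rpower mu (p - 1)) in Y.
assert (HA : 0 < A) by (unfold A; nra).
assert (Hps : 0 < p * s) by nra.
assert (HZ : 0 < 2 / d) by (apply Rmult_lt_0_compat; [lra|apply Rinv_0_lt_compat; lra]).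
assert (E1 : 2 / d <= d * Rpower mu p).
{ apply Rle_trans with (d * B1); [right; unfold B1; field; lra|apply Rmult_le_compat_l; lra]. }
assert (E2 : 2 / d <= p * s * Rpower mu p).
{ apply Rle_trans with (p * s * B2); [right; unfold B2; field; lra|apply Rmult_le_compat_l; lra]. }
assert (E3 : Rabs (ln (f T1)) + 2 * Rpower T1 p <= d / 4 * Rpower mu p).
{ apply Rle_trans with (d / 4 * B3); [right; unfold B3; field; lra|apply Rmult_le_compat_l; lra]. }
split; [apply HL1; lra|]. split; [exact E1|].
assert (Yp := exp_pos (p * ln mu)); fold (Rpower mu p) in Yp.
split; [nra|]. intros a Ha.
assert (Hsa : (1 - s) * mu <= a).
{ assert (2 / d / A <= s * mu); [|lra].
  apply (Rmult_le_reg_r A); [exact HA|].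
  replace (2 / d / A * A) with (2 / d) by (field; lra).
  rewrite (Rpower_succ mu p) in E2 by lra. unfold A; nra. }
assert (Ha2 : mu / 2 <= a) by nra.
assert (Hmu0 : 0 < mu) by lra.
assert (Q1 : (1 - s1) * mu <= a) by nra.
assert (Q2 : (1 - s2) * mu <= a) by nra.
assert (V1 := HS1 mu a ltac:(lra) ltac:(lra)).
assert (V2 := HS2 mu a ltac:(lra) ltac:(lra)).
split; [lra|]. split; [nra|].
destruct (HG2 a ltac:(lra)) as [fa [G [DG HG]]].
split; [exact fa|]. split.
{ exists G; split; [exact DG|].
  assert ((1 - d / 4) * A <= p * Rpower a (p - 1) <= (1 + d / 4) * A) by (unfold A; nra).
  assert (0 < p * Rpower a (p - 1)) by (apply Rmult_lt_0_compat; [lra|apply exp_pos]).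
  split.
  - apply Rle_trans with ((1 - d / 4) * ((1 - d / 4) * A)); [nra|].
    eapply Rle_trans; [|apply HG]. apply Rmult_le_compat_l; lra.
  - apply Rle_trans with ((1 + d / 4) * ((1 + d / 4) * A)); [|nra].
    eapply Rle_trans; [apply HG|]. apply Rmult_le_compat_l; lra. }
split.
{ intros v Hv. eapply Rle_trans; [apply (HG3 v a); lra|].
  apply Rmult_le_compat_l; [lra|]. apply exp_le.
  assert (P := rpow_chord p v a Hp Hv ltac:(lra)). rewrite Hmin in P.
  assert (K : k * ((1 / 2 + 8 * c) * p * Rpower a (p - 1) * (a - v)) <= k * (rpow a p - rpow v p)).
  { apply Rmult_le_compat_l; [|exact P]. nra. }
  replace (k * ((1 / 2 + 8 * c) * p * Rpower a (p - 1) * (a - v))) with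
    ((k * (1 / 2 + 8 * c)) * (p * Rpower a (p - 1) * (a - v))) in K by ring.
  rewrite Hk in K.
  assert ((1 / 2 + 2 * c) * A <= (1 / 2 + 4 * c) * (p * Rpower a (p - 1))).
  { apply Rle_trans with ((1 / 2 + 4 * c) * ((1 - d / 4) * A)).
    { rewrite <- Rmult_assoc; apply Rmult_le_compat_r; [lra|].
      assert (c * d <= c * (1 / 8)) by (apply Rmult_le_compat_l; lra). nra. }
    apply Rmult_le_compat_l; [lra|]. unfold A; nra. }
  assert ((1 / 2 + 2 * c) * A * (a - v) <= (1 / 2 + 4 * c) * (p * Rpower a (p - 1)) * (a - v))
    by (apply Rmult_le_compat_r; lra).
  lra. }
(* Comparison with the fixed point T1 gives ln (f a) with errors of d / 4 from the rate, from
   replacing a^p by mu^p, and from [E3], all within d. *)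
destruct (HG1 T1 a ltac:(lra)) as [G1 G2].
assert (fT := fpos T1 (Rle_refl _)).
assert (YT := exp_pos (p * ln T1)); fold (Rpower T1 p) in YT.
assert (Hl := Rabs_le_between (ln (f T1)) (Rabs (ln (f T1)))).
destruct Hl as [Hl _]; specialize (Hl (Rle_refl _)).
apply ln_le in G1; [|apply Rmult_lt_0_compat; [lra|apply exp_pos]].
apply ln_le in G2; [|lra].
rewrite ln_mult, ln_exp in G1, G2 by (try apply exp_pos; lra).
split; nra.
Qed.

(** * Concentration of a single solution *)

(* Multiplied by [r], the equation also makes sense at [r = 0]. *)
Definition radial_profile (f : R -> R) (lambda mu : R) (v v1 v2 : R -> R) : Prop :=
  (forall r, continuity_pt v r) /\ (forall r, continuity_pt v1 r) /\
  (forall r, continuity_pt v2 r) /\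
  (forall r, 0 < r < 1 -> is_derive v r (v1 r) /\ is_derive v1 r (v2 r)) /\
  (forall r, 0 <= r <= 1 -> r * v2 r + v1 r = - (lambda * f (v r) * r)) /\
  (forall r, 0 <= r <= 1 -> 0 <= v r) /\ v 0 = mu /\ v 1 = 0.

(** [e] is the total deviation of M from 4: [8 d] from the bubble and [6 d / c] from the tail. The
    radius [r0] depends on the solution and stays a separate quantity; ln (1 / r0) is tied once to
    mu^p and once to lambda. *)
Lemma concentration (p : R) (f : R -> R) (c d : R) : 0 < p ->
  0 < c -> Rmin 1 p = (1 / 2 + 8 * c) * p -> 0 < d <= 1 / 30 -> 2 * d <= c ->
  (forall t, 0 <= t -> 0 <= f t) ->
  locally_bounded_above f -> asymptotic_log_derivative p f ->
  exists mu0, 0 < mu0 /\ forall lambda mu v v1 v2, mu0 <= mu -> 0 < lambda ->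
    radial_profile f lambda mu v v1 v2 ->
    let A := p * Rpower mu (p - 1) in
    let e := 8 * d + 6 * d / c in
    exists r0, 0 < r0 < 1 /\
    (forall r, r0 <= r <= 1 ->
       4 - e <= - A * (r * v1 r) <= 4 + e /\
       0 <= A * (lambda * f (v r) * r) * r <= 30 * d) /\
    (forall r, 0 <= r <= r0 -> 0 <= mu - v r <= d * mu) /\
    (forall r, 0 <= r <= 1 -> v r <= mu) /\
    (4 - e) * ln (1 / r0) <= p * Rpower mu p /\
    (p - d) * Rpower mu p <= (4 + e) * ln (1 / r0) /\
    (1 - 2 * d) * Rpower mu p - 2 * ln (1 / r0) <= ln (1 / lambda)
      <= (1 + 2 * d) * Rpower mu p - 2 * ln (1 / r0).
Proof.
intros Hp Hc Hmin Hd Hdc f0 Hb Hf.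
destruct (growth_near_maximum p f c d Hp Hc Hmin ltac:(lra) Hdc f0 Hb Hf) as [mu0 [Hmu0 H]].
exists mu0; split; [exact Hmu0|].
intros lambda mu v v1 v2 Hmu Hlam [Cv [Cv1 [Cv2 [Dv [Eq [v0 [v00 v10]]]]]]] A e.
destruct (H mu Hmu) as [HlnA [HZ1 [HZ2 Hnear]]]; fold A in HlnA, Hnear; clear H.
assert (Y := exp_pos ((p - 1) * ln mu)); fold (Rpower mu (p - 1)) in Y.
assert (Yp := exp_pos (p * ln mu)); fold (Rpower mu p) in Yp.
assert (HA : 0 < A) by (unfold A; nra).
assert (HAmu : A * mu = p * Rpower mu p)
  by (rewrite (Rpower_succ mu p) by lra; unfold A; ring).
set (z := fun r => A * (mu - v r)).
set (M := fun r => - A * (r * v1 r)).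
(* Expressed through [v2] rather than f, W is continuous on the whole line without any continuity of
   f. *)
set (W := fun r => - A * (r * (r * v2 r + v1 r))).
assert (HW : forall r, 0 <= r <= 1 -> W r = A * (lambda * f (v r) * r) * r)
  by (intros r Hr; unfold W; rewrite (Eq r Hr); ring).
assert (Cid : forall r, continuity_pt (fun r => r) r)
  by (intros r; apply derivable_continuous_pt, derivable_pt_id).
assert (Cc : forall k r, continuity_pt (fun _ => k) r)
  by (intros k r; apply continuity_pt_const; now intros ? ?).
assert (Cz : forall r, continuity_pt z r).
{ intros r; apply continuity_pt_mult; [apply Cc|]. apply continuity_pt_minus; [apply Cc|apply Cv]. }
assert (CM : forall r, continuity_pt M r).
{ intros r; apply continuity_pt_mult; [apply Cc|]. apply continuity_pt_mult; [apply Cid|apply Cv1]. }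
assert (CW : forall r, continuity_pt W r).
{ intros r; apply continuity_pt_mult; [apply Cc|]. apply continuity_pt_mult; [apply Cid|].
  apply continuity_pt_plus; [|apply Cv1]. apply continuity_pt_mult; [apply Cid|apply Cv2]. }
assert (Dz : forall r, 0 < r < 1 -> is_derive z r (M r / r)).
{ intros r Hr; destruct (Dv r Hr) as [D1 D2]. unfold z, M; derive_from_context; field; lra. }
assert (DM : forall r, 0 < r < 1 -> is_derive M r (W r / r)).
{ intros r Hr; destruct (Dv r Hr) as [D1 D2]. unfold M, W; derive_from_context; field; lra. }
assert (W0 : forall r, 0 <= r <= 1 -> 0 <= W r).
{ intros r Hr; rewrite HW by exact Hr.
  assert (0 <= f (v r)) by (apply f0, v0, Hr).
  repeat apply Rmult_le_pos; lra. }
assert (Minc := radial_mass_increasing M W DM CM W0).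
assert (M00 : M 0 = 0) by (unfold M; ring).
assert (M0 : forall r, 0 <= r <= 1 -> 0 <= M r) by (intros r Hr; rewrite <- M00; apply Minc; lra).
assert (zinc : forall r s, 0 <= r -> r <= s -> s <= 1 -> z r <= z s).
{ intros r s Hr Hrs Hs; apply le_of_derive_nonneg; [exact Hrs| |auto].
  intros x Hx; eexists; split; [apply Dz; lra|].
  apply Rmult_le_pos; [apply M0; lra|left; apply Rinv_0_lt_compat; lra]. }
assert (z00 : z 0 = 0) by (unfold z; rewrite v00; ring).
assert (z1 : z 1 = p * Rpower mu p) by (unfold z; rewrite v10, Rminus_0_r; exact HAmu).
assert (HZ0 : 0 < 2 / d) by (apply Rmult_lt_0_compat; [lra|apply Rinv_0_lt_compat; lra]).
(* [r0] is where z reaches the level required by [bubble_mass]; the level lies below z 1 because mu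
   is large. *)
destruct (IVT_gen z 0 1 (2 / d)) as [r0 [Hr0 zr0]].
{ intros r; apply Cz. }
{ rewrite z00, z1, Rmin_left, Rmax_right; lra. }
rewrite Rmin_left, Rmax_right in Hr0 by lra.
assert (Hr0' : 0 < r0 < 1).
{ split; apply Rnot_le_lt; intros N.
  - replace r0 with 0 in zr0 by lra; lra.
  - replace r0 with 1 in zr0 by lra; lra. }
assert (vz : forall r, v r = mu - z r / A) by (intros r; unfold z; field; lra).
assert (Hvnear : forall r, 0 <= r <= r0 -> mu - 2 / d / A <= v r <= mu).
{ intros r Hr; rewrite vz.
  assert (z r <= 2 / d) by (rewrite <- zr0; apply zinc; lra).
  assert (0 <= z r) by (rewrite <- z00; apply zinc; lra).
  assert (0 <= z r / A) by (apply Rmult_le_pos; [lra|left; apply Rinv_0_lt_compat; lra]).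
  assert (z r / A <= 2 / d / A)
    by (apply Rmult_le_compat_r; [left; apply Rinv_0_lt_compat; lra|lra]).
  lra. }
assert (DW : forall r, 0 < r < r0 -> exists g, 1 - d <= g <= 1 + d /\
     is_derive W r (W r * (2 - g * M r) / r)).
{ intros r Hr; destruct (Dv r ltac:(lra)) as [D1 _].
  destruct (Hnear (v r) ltac:(apply Hvnear; lra)) as [_ [_ [_ [[G [DG HG]] _]]]].
  exists (G / A); split.
  - split; apply (Rmult_le_reg_r A); try lra; unfold Rdiv; rewrite Rmult_assoc, Rinv_l; lra.
  - apply is_derive_ext_loc with (fun s => A * lambda * (s * s) * f (v s)).
    { assert (Hm : 0 < Rmin r (1 - r)) by (apply Rmin_pos; lra).
      exists (mkposreal _ Hm); intros y Hy.
      apply Rabs_def2 in Hy; simpl in Hy; unfold minus, plus, opp in Hy; simpl in Hy.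
      assert (G1 := Rmin_l r (1 - r)); assert (G2 := Rmin_r r (1 - r)).
      rewrite HW by lra; apply Rminus_diag_uniq; ring. }
    rewrite HW by lra. unfold M. derive_from_context.
    field; lra. }
assert (Tail : forall r, r0 <= r <= 1 ->
     W r <= W r0 * (r / r0)^2 * exp (- (1 / 2 + 2 * c) * (z r - z r0))).
{ intros r Hr; rewrite !HW by lra.
  destruct (Hnear (v r0) ltac:(apply Hvnear; lra)) as [_ [_ [_ [_ [Hdec _]]]]].
  assert (Hle : v r <= v r0).
  { rewrite !vz. assert (z r0 / A <= z r / A); [|lra].
    apply Rmult_le_compat_r; [left; apply Rinv_0_lt_compat; lra|apply zinc; lra]. }
  specialize (Hdec (v r) (conj (v0 r ltac:(lra)) Hle)).
  replace (- ((1 / 2 + 2 * c) * A) * (v r0 - v r)) with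
    (- (1 / 2 + 2 * c) * (z r - z r0)) in Hdec by (unfold z; ring).
  replace (A * (lambda * f (v r0) * r0) * r0 * (r / r0) ^ 2 *
    exp (- (1 / 2 + 2 * c) * (z r - z r0))) with
    (A * lambda * (r * r) * (f (v r0) * exp (- (1 / 2 + 2 * c) * (z r - z r0))))
    by (field; lra).
  replace (A * (lambda * f (v r) * r) * r) with (A * lambda * (r * r) * f (v r)) by ring.
  apply Rmult_le_compat_l; [|exact Hdec].
  repeat apply Rmult_le_pos; lra. }
assert (W00 : W 0 = 0) by (unfold W; ring).
assert (Phase := phase_concentration z M W r0 d c (1 / 2 + 2 * c) Hr0' ltac:(lra) Hdc Dz DM Cz CM CW
  W0 DW z00 M00 W00 ltac:(lra) Tail ltac:(lra)).
assert (He : 0 <= 6 * d / c) by (apply Rmult_le_pos; [lra|left; apply Rinv_0_lt_compat; lra]).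
assert (Phase' : forall r, r0 <= r <= 1 -> 4 - e <= M r <= 4 + e /\ 0 <= W r <= 30 * d).
{ intros r Hr; destruct (Phase r Hr) as [P1 P2]; unfold e. assert (G := W0 r ltac:(lra)).
  split; split; lra. }
assert (Hvmu : forall r, 0 <= r <= 1 -> v r <= mu).
{ intros r Hr; assert (0 <= z r) by (rewrite <- z00; apply zinc; lra).
  unfold z in H. apply Rnot_lt_le; intros N. nra. }
exists r0; split; [exact Hr0'|]. split.
{ intros r Hr. rewrite <- HW by lra. exact (Phase' r Hr). }
split.
{ intros r Hr; destruct (Hnear (v r) (Hvnear r Hr)) as [_ [G _]].
  assert (G2 := Hvnear r Hr); lra. }
split; [exact Hvmu|].
assert (Hln : ln (1 / r0) = - ln r0) by (unfold Rdiv; rewrite Rmult_1_l, ln_Rinv by lra; reflexivity).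
assert (Dlog : forall k r, r0 < r < 1 ->
  is_derive (fun s => z s - k * ln s) r ((M r - k) / r)).
{ intros k r Hr; assert (Dzr := Dz r ltac:(lra)).
  derive_from_context; [lra|field; lra]. }
assert (Clog : forall k r, r0 <= r <= 1 -> continuity_pt (fun s => z s - k * ln s) r).
{ intros k r Hr; apply continuity_pt_minus; [apply Cz|]. apply continuity_pt_mult; [apply Cc|].
  apply derivable_continuous_pt; exists (/ r); apply derivable_pt_lim_ln; lra. }
assert (Lo : (4 - e) * ln (1 / r0) <= p * Rpower mu p).
{ set (G := fun s => z s - (4 - e) * ln s).
  assert (HG : G r0 <= G 1).
  { apply le_of_derive_nonneg; [lra| |apply Clog].
    intros r Hr; eexists; split; [apply Dlog, Hr|].
    apply Rmult_le_pos; [|left; apply Rinv_0_lt_compat; lra].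
    destruct (Phase' r ltac:(lra)); lra. }
  unfold G in HG; rewrite ln_1, zr0, z1 in HG; rewrite Hln; lra. }
(* The loss [d] accounts for z r0 = 2 / d <= d * mu^p, the part of z gained before [r0]. *)
assert (Up : (p - d) * Rpower mu p <= (4 + e) * ln (1 / r0)).
{ set (G := fun s => - (z s - (4 + e) * ln s)).
  assert (HG : G r0 <= G 1).
  { apply le_of_derive_nonneg; [lra| |intros; apply continuity_pt_opp, Clog; assumption].
    intros r Hr; eexists; split;
      [apply (is_derive_opp (fun s => z s - (4 + e) * ln s)), Dlog, Hr|].
    unfold opp; simpl; replace (- ((M r - (4 + e)) / r)) with ((4 + e - M r) / r) by (field; lra).
    apply Rmult_le_pos; [|left; apply Rinv_0_lt_compat; lra].
    destruct (Phase' r ltac:(lra)); lra. }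
  unfold G in HG; rewrite ln_1, zr0, z1 in HG; rewrite Hln; lra. }
split; [exact Lo|]. split; [exact Up|].
assert (Hlnl : ln (1 / lambda) = - ln lambda)
  by (unfold Rdiv; rewrite Rmult_1_l, ln_Rinv by lra; reflexivity).
apply Rabs_le_between in HlnA.
assert (HZA : 0 < 2 / d / A) by (apply Rmult_lt_0_compat; [lra|apply Rinv_0_lt_compat; lra]).
destruct (Hnear mu ltac:(lra)) as [mupos [_ [fmu [_ [Hdec Hlnmu]]]]].
destruct (Hnear (v r0) ltac:(apply Hvnear; lra)) as [_ [_ [fv [_ [_ Hlnv]]]]].
destruct (Phase r0 ltac:(lra)) as [PM PW].
rewrite Hln, Hlnl; split.
(* d <= 1 / 30 makes W r0 <= 1, so its logarithm bounds lambda from above. W r0 has no useful lower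
   bound here, so the other direction uses M r0 instead. *)
- assert (ln (A * (lambda * f (v r0) * r0) * r0) <= ln 1).
  { apply ln_le; [repeat apply Rmult_lt_0_compat; lra|]. rewrite <- HW by lra; lra. }
  rewrite ln_1, !ln_mult in H by (repeat apply Rmult_lt_0_compat; lra). lra.
- (* [f (v r) <= f mu] gives [1 <= M r0 <= A * lambda * f mu * r0^2]. *)
  assert (ln 1 <= ln (A * (lambda * f mu * r0) * r0)).
  { apply ln_le; [lra|].
    set (G := fun s => A * lambda * f mu * (s * s) - M s).
    assert (HG : G 0 <= G r0).
    { apply le_of_derive_nonneg; [lra| |].
      - intros r Hr; assert (DMr := DM r ltac:(lra)).
        exists (A * lambda * f mu * (2 * r) - W r / r); split.
        { unfold G; derive_from_context; ring. }
        rewrite HW by lra.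
        assert (f (v r) <= f mu).
        { eapply Rle_trans; [apply (Hdec (v r)); split; [apply v0; lra|apply Hvmu; lra]|].
          rewrite <- (Rmult_1_r (f mu)) at 2; apply Rmult_le_compat_l; [lra|].
          apply Rle_trans with (exp 0); [apply exp_le|right; apply exp_0].
          assert (v r <= mu) by (apply Hvmu; lra).
          assert (0 <= (1 / 2 + 2 * c) * A * (mu - v r)).
          { apply Rmult_le_pos; [apply Rmult_le_pos|]; lra. }
          lra. }
        replace (A * lambda * f mu * (2 * r) - A * (lambda * f (v r) * r) * r / r) with
          (A * lambda * r * (f mu + (f mu - f (v r)))) by (field; lra).
        repeat apply Rmult_le_pos; lra.
      - intros r Hr; apply continuity_pt_minus; [|apply CM].
        apply continuity_pt_mult; [apply Cc|]. apply continuity_pt_mult; apply Cid. }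
    unfold G in HG; rewrite M00 in HG; lra. }
  rewrite ln_1, !ln_mult in H by (repeat apply Rmult_lt_0_compat; lra). lra.
Qed.

(* The derivatives in [is_solution] are one-sided at 0 and 1; precomposing with
   [clamp] yields functions continuous on all of [R]. *)
Definition clamp (r : R) : R := Rmax 0 (Rmin 1 r).

Lemma clamp_bounds (r : R) : 0 <= clamp r <= 1.
Proof.
unfold clamp; split; [apply Rmax_l|apply Rmax_lub; [lra|apply Rmin_l]].
Qed.

Lemma clamp_id (r : R) : 0 <= r <= 1 -> clamp r = r.
Proof. intros Hr; unfold clamp; rewrite Rmin_right, Rmax_right; lra. Qed.

Lemma clamp_lipschitz (x y : R) : Rabs (clamp x - clamp y) <= Rabs (x - y).
Proof.
unfold clamp, Rmax, Rmin.
destruct (Rle_dec 1 x); destruct (Rle_dec 1 y);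
repeat (match goal with |- context [Rle_dec ?a ?b] => destruct (Rle_dec a b) end);
unfold Rabs; repeat destruct Rcase_abs; lra.
Qed.

Lemma is_derive_clamp (g g' : R -> R) (r : R) :
  derivative_on (fun r => 0 <= r <= 1) g g' -> 0 < r < 1 ->
  is_derive (fun x => g (clamp x)) r (g' (clamp r)).
Proof.
intros Hg Hr; rewrite clamp_id by lra.
assert (Hm : 0 < Rmin r (1 - r)) by (apply Rmin_pos; lra).
assert (Hin : forall y, Rabs (y - r) < Rmin r (1 - r) -> 0 <= y <= 1).
{ intros y Hy; apply Rabs_def2 in Hy.
  assert (G1 := Rmin_l r (1 - r)); assert (G2 := Rmin_r r (1 - r)); lra. }
apply is_derive_ext_loc with g.
- exists (mkposreal _ Hm); intros y Hy; rewrite clamp_id; [reflexivity|].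
  now apply Hin.
- now apply (derivative_on_is_derive _ g g' r _ Hg Hm).
Qed.

Lemma solution_profile (f : R -> R) (lambda mu : R) (u u' u'' : R -> R) :
  derivative_on (fun r => 0 <= r <= 1) u u' ->
  derivative_on (fun r => 0 <= r <= 1) u' u'' ->
  Defs.continuous_on (fun r => 0 <= r <= 1) u'' ->
  (forall r, 0 < r <= 1 -> - u'' r - 1 / r * u' r = lambda * f (u r)) ->
  (forall r, 0 < r < 1 -> 0 < u r) -> 0 < mu ->
  u 0 = mu -> u' 0 = 0 -> u 1 = 0 ->
  radial_profile f lambda mu (fun r => u (clamp r)) (fun r => u' (clamp r))
    (fun r => u'' (clamp r)).
Proof.
intros Du Du' Cu'' Heq Hpos Hmu u0 u'0 u1.
assert (C : forall g, Defs.continuous_on (fun r => 0 <= r <= 1) g ->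
  forall r, continuity_pt (fun r => g (clamp r)) r).
{ intros g Hg; apply (continuous_on_retraction (fun r => 0 <= r <= 1)).
  - apply clamp_bounds.
  - apply clamp_lipschitz.
  - exact Hg. }
split; [|split; [|split; [|split; [|split; [|split; [|split]]]]]].
- apply C; intros x Hx; now apply cont_deriv with u', Du.
- apply C; intros x Hx; now apply cont_deriv with u'', Du'.
- now apply C.
- split; [now apply (is_derive_clamp u u')|now apply (is_derive_clamp u' u'')].
- intros r Hr; rewrite clamp_id by lra.
  (* At r = 0 the equation multiplied by r reduces to [u' 0 = 0]. *)
  destruct (Rle_lt_or_eq_dec 0 r) as [H|<-]; [lra| |rewrite u'0; ring].
  rewrite <- Heq by lra; field; lra.
- intros r Hr; rewrite clamp_id by lra.
  destruct (Req_dec r 0) as [->|N0]; [lra|].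
  destruct (Req_dec r 1) as [->|N1]; [lra|].
  left; apply Hpos; lra.
- now rewrite clamp_id by lra.
- now rewrite clamp_id by lra.
Qed.

(** * Integrals, the logarithmic profile and compact sets *)

(** The density lambda f(v) r equals -(r v1)', so a * v1 a - b * v1 b is the unweighted mass on
    [a, b]. The weighted primitive plus k * (x * v1 x) has derivative (w - k) times a nonnegative
    density, which settles both inequalities and is exact for constant weight. *)
Lemma weighted_mass_bounds (f : R -> R) (lambda mu : R) (v v1 v2 w : R -> R)
  (m1 m2 a b : R) : 0 < lambda -> (forall t, 0 <= t -> 0 <= f t) ->
  radial_profile f lambda mu v v1 v2 -> (forall r, continuity_pt w r) ->
  0 <= a -> a <= b -> b <= 1 -> (forall r, a < r < b -> m1 <= w r <= m2) ->
  exists I, is_RInt (fun r => w r * (lambda * f (v r) * r)) a b I /\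
    m1 * (a * v1 a - b * v1 b) <= I <= m2 * (a * v1 a - b * v1 b).
Proof.
intros Hl f0 [Cv [Cv1 [Cv2 [Dv [Eq [v0 _]]]]]] Cw Ha Hab Hb Hw.
assert (Cid : forall r, continuity_pt (fun r => r) r)
  by (intros r; apply derivable_continuous_pt, derivable_pt_id).
assert (Cc : forall k r, continuity_pt (fun _ => k) r)
  by (intros k r; apply continuity_pt_const; now intros ? ?).
set (q := fun r => - (r * v2 r + v1 r)).
assert (Cq : forall r, continuity_pt q r).
{ intros r; apply continuity_pt_opp, continuity_pt_plus; [|apply Cv1].
  apply continuity_pt_mult; [apply Cid|apply Cv2]. }
set (g := fun r => w r * q r).
assert (Cg : forall r, continuous g r).
{ intros r; apply continuity_pt_filterlim, continuity_pt_mult; [apply Cw|apply Cq]. }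
assert (Ig : forall x, is_RInt g a x (RInt g a x)).
{ intros x; apply (RInt_correct g a x), ex_RInt_continuous; intros; apply Cg. }
assert (Dg : forall x, is_derive (RInt g a) x (g x)).
{ intros x; apply is_derive_RInt with a; [|apply Cg]. apply filter_forall, Ig. }
assert (CJ : forall x, continuity_pt (RInt g a) x)
  by (intros x; eapply is_derive_continuity_pt, Dg).
assert (CF : forall k x, continuity_pt (fun x => k * (x * v1 x)) x).
{ intros k x; apply continuity_pt_mult; [apply Cc|].
  apply continuity_pt_mult; [apply Cid|apply Cv1]. }
assert (q0 : forall x, a < x < b -> 0 <= q x).
{ intros x Hx; unfold q; rewrite Eq by lra.
  assert (0 <= f (v x)) by (apply f0, v0; lra).
  rewrite Ropp_involutive; repeat apply Rmult_le_pos; lra. }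
assert (Ja : RInt g a a = 0) by apply (RInt_point (V := R_CompleteNormedModule)).
assert (D : forall k x, a < x < b ->
  is_derive (fun x => RInt g a x + k * (x * v1 x)) x ((w x - k) * q x)).
{ intros k x Hx; assert (E1 := Dg x). destruct (Dv x ltac:(lra)) as [E2 E3].
  replace ((w x - k) * q x) with (plus (g x) (k * (v1 x + x * v2 x)))
    by (unfold plus, g, q; simpl; ring).
  apply (is_derive_plus (RInt g a) (fun x => k * (x * v1 x))); [exact E1|].
  derive_from_context; ring. }
exists (RInt g a b); split; [|split].
- apply is_RInt_ext with g; [|apply Ig].
  rewrite Rmin_left, Rmax_right by lra. intros x Hx; unfold g, q; rewrite Eq by lra.
  apply Rminus_diag_uniq; ring.
- set (G := fun x => RInt g a x + m1 * (x * v1 x)).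
  assert (H : G a <= G b).
  { apply le_of_derive_nonneg; [lra| |].
    - intros x Hx; eexists; split; [apply D, Hx|].
      apply Rmult_le_pos; [specialize (Hw x Hx); lra|now apply q0].
    - intros x Hx; apply continuity_pt_plus; [apply CJ|apply CF]. }
  unfold G in H; rewrite Ja in H; lra.
- set (G := fun x => - (RInt g a x + m2 * (x * v1 x))).
  assert (H : G a <= G b).
  { apply le_of_derive_nonneg; [lra| |].
    - intros x Hx; eexists; split;
        [apply (is_derive_opp (fun x => RInt g a x + m2 * (x * v1 x))), D, Hx|].
      unfold opp; simpl; rewrite Ropp_mult_distr_l.
      apply Rmult_le_pos; [specialize (Hw x Hx); lra|now apply q0].
    - intros x Hx; apply continuity_pt_opp, continuity_pt_plus; [apply CJ|apply CF]. }
  unfold G in H; rewrite Ja in H; lra.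
Qed.

(** Both A v + (4 + e) ln r and -(A v + (4 - e) ln r) are nondecreasing and vanish at r = 1. The
    error is thus at most e ln (1 / r), largest at r = a. *)
Lemma profile_near_log (v v1 : R -> R) (A e a : R) : 0 < a ->
  (forall r, continuity_pt v r) ->
  (forall r, 0 < r < 1 -> is_derive v r (v1 r)) -> v 1 = 0 ->
  (forall r, a <= r <= 1 -> 4 - e <= - A * (r * v1 r) <= 4 + e) ->
  forall r, a <= r <= 1 -> Rabs (A * v r - 4 * ln (1 / r)) <= e * ln (1 / a).
Proof.
intros Ha Cv Dv v10 HM r Hr.
assert (He : 0 <= e) by (specialize (HM r Hr); lra).
assert (Cc : forall k r, continuity_pt (fun _ => k) r)
  by (intros k s; apply continuity_pt_const; now intros ? ?).
assert (D : forall k s, a < s < 1 ->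
  is_derive (fun s => A * v s + k * ln s) s ((A * (s * v1 s) + k) / s)).
{ intros k s Hs; assert (E := Dv s ltac:(lra)); derive_from_context; [lra|field; lra]. }
assert (C : forall k s, a <= s -> continuity_pt (fun s => A * v s + k * ln s) s).
{ intros k s Hs; apply continuity_pt_plus.
  - apply continuity_pt_mult; [apply Cc|apply Cv].
  - apply continuity_pt_mult; [apply Cc|].
    apply derivable_continuous_pt; exists (/ s); apply derivable_pt_lim_ln; lra. }
assert (L : ln r <= 0) by (rewrite <- ln_1; apply ln_le; lra).
assert (L' : ln a <= ln r) by (apply ln_le; lra).
unfold Rdiv; rewrite !Rmult_1_l, !ln_Rinv by lra.
assert (U : A * v r + (4 + e) * ln r <= 0).
{ set (G := fun s => A * v s + (4 + e) * ln s).
  assert (H : G r <= G 1).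
  { apply le_of_derive_nonneg; [lra| |intros; apply C; lra].
    intros s Hs; eexists; split; [apply D; lra|].
    apply Rmult_le_pos; [|left; apply Rinv_0_lt_compat; lra].
    specialize (HM s ltac:(lra)); lra. }
  unfold G in H; rewrite v10, ln_1 in H; lra. }
assert (V : 0 <= A * v r + (4 - e) * ln r).
{ set (G := fun s => - (A * v s + (4 - e) * ln s)).
  assert (H : G r <= G 1).
  { apply le_of_derive_nonneg; [lra| |intros; apply continuity_pt_opp, C; lra].
    intros s Hs; eexists; split;
      [apply (is_derive_opp (fun s => A * v s + (4 - e) * ln s)), D; lra|].
    unfold opp, Rdiv; simpl; rewrite Ropp_mult_distr_l.
    apply Rmult_le_pos; [|left; apply Rinv_0_lt_compat; lra].
    specialize (HM s ltac:(lra)); lra. }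
  unfold G in H; rewrite v10, ln_1 in H; lra. }
apply Rabs_le; split; nra.
Qed.

(** A compact set is closed, so the point 0 outside it has a disc disjoint from it. *)
Lemma compact_away_from_0 (K : R -> Prop) :
  compact K -> included K (fun r => 0 < r <= 1) ->
  exists a, 0 < a <= 1 /\ forall x, K x -> a <= x <= 1.
Proof.
intros HK HD.
destruct (compact_P2 K HK 0) as [d Hd].
{ intros H; apply HD in H; lra. }
exists (Rmin d 1); split.
{ split; [apply Rmin_pos; [apply cond_pos|lra]|apply Rmin_r]. }
intros x Hx; assert (Hx' := HD x Hx); split; [|lra].
apply Rnot_lt_le; intros N; apply (Hd x); [|exact Hx].
unfold disc; rewrite Rminus_0_r, Rabs_pos_eq by lra.
eapply Rlt_le_trans; [exact N|apply Rmin_l].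
Qed.

Lemma D_in_included (D D' : R -> Prop) (g g' : R -> R) (x : R) :
  included D' D -> D_in g g' D x -> D_in g g' D' x.
Proof.
intros HD Hg eps Heps; destruct (Hg eps Heps) as [a [Ha H]].
exists a; split; [exact Ha|]; intros y [[Hy Hy'] Hd]; apply H; split; [split; [now apply HD|exact Hy']|exact Hd].
Qed.

Lemma is_derive_D_in (D : R -> Prop) (g g' : R -> R) (x : R) :
  is_derive g x (g' x) -> D_in g g' D x.
Proof.
intros H; apply D_in_included with no_cond; [now intros y _|].
now apply derivable_pt_lim_D_in, is_derive_Reals.
Qed.

(** * Asymptotics in one small parameter and passage to the sequence *)

(** The constant (2 - p) / 2 is 1 - p / 2: ln (1 / lambda) is about mu^p - 2 ln (1 / r0), where mu^p
    comes from ln f near the maximum and ln (1 / r0) is about p mu^p / 4. *)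
Lemma concentration_asymptotics (p : R) (f : R -> R) (eps : R) : 0 < p < 2 ->
  0 < eps <= 1 -> (forall t, 0 <= t -> 0 <= f t) ->
  locally_bounded_above f -> asymptotic_log_derivative p f ->
  exists mu0, 0 < mu0 /\ forall lambda mu v v1 v2, mu0 <= mu -> 0 < lambda ->
    radial_profile f lambda mu v v1 v2 ->
    let A := p * Rpower mu (p - 1) in
    exists r0, 0 < r0 < 1 /\
    (forall r, r0 <= r <= 1 ->
       4 - eps / 10 <= - A * (r * v1 r) <= 4 + eps / 10 /\
       0 <= A * (lambda * f (v r) * r) * r <= eps / 10) /\
    (forall r, 0 <= r <= r0 -> (1 - eps / 10) * mu <= v r) /\
    (forall r, 0 <= r <= 1 -> v r <= mu) /\
    p / 10 * Rpower mu p <= ln (1 / r0) /\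
    Rabs (ln (1 / lambda) - (2 - p) / 2 * Rpower mu p) <= eps / 2 * Rpower mu p.
Proof.
intros Hp Heps f0 Hb Hf.
set (c := (Rmin 1 p / p - 1 / 2) / 8).
assert (Hc : Rmin 1 p = (1 / 2 + 8 * c) * p) by (unfold c; field; lra).
clearbody c.
(* Positivity of the margin is min(1, p) > p / 2, which is where p < 2 is decisive. *)
assert (Hc0 : 0 < c).
{ apply Rnot_le_lt; intros N; assert (0 <= - c * p) by (apply Rmult_le_pos; lra).
  unfold Rmin in Hc; destruct (Rle_dec 1 p); lra. }
assert (Hc1 : c <= 1 / 16) by (assert (G := Rmin_r 1 p); nra).
(* The factor [c] cancels the denominator of 6 d / c, and the factor [p] keeps p - d at least p /
   2. *)
set (d := c * eps * p / 200).
assert (Hcep : 0 < c * eps * p) by (repeat apply Rmult_lt_0_compat; lra).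
assert (Hd : 0 < d) by (unfold d; lra).
assert (Hce : c * eps <= 1 / 16 * eps) by (apply Rmult_le_compat_r; lra).
assert (Hce2 : c * eps <= c * 1) by (apply Rmult_le_compat_l; lra).
assert (Hce3 : c * eps * p <= c * eps * 2) by (apply Rmult_le_compat_l; nra).
assert (Hce4 : c * eps * p <= 1 * p) by (apply Rmult_le_compat_r; lra).
assert (Hd1 : d <= eps / 1000) by (unfold d; lra).
assert (Hd2 : 2 * d <= c) by (unfold d; lra).
assert (Hd3 : d <= p / 2) by (unfold d; lra).
assert (He : 8 * d + 6 * d / c <= eps / 10).
{ replace (6 * d / c) with (6 * (eps * p / 200)) by (unfold d; field; lra). nra. }
assert (He0 : 0 < 6 * d / c) by (apply Rmult_lt_0_compat; [lra|now apply Rinv_0_lt_compat]).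
destruct (concentration p f c d ltac:(lra) Hc0 Hc ltac:(lra) Hd2 f0 Hb Hf) as [mu0 [Hmu0 H]].
exists mu0; split; [exact Hmu0|].
intros lambda mu v v1 v2 Hmu Hl Hv A.
destruct (H lambda mu v v1 v2 Hmu Hl Hv) as [r0 [Hr0 [HM [Hnear [Hvmu [L1 [L2 L3]]]]]]].
assert (He1 : 0 <= 8 * d + 6 * d / c) by lra.
set (e := 8 * d + 6 * d / c) in *. fold A in HM. clearbody e.
set (Y := Rpower mu p) in *.
assert (HY : 0 < Y) by apply exp_pos.
exists r0; split; [exact Hr0|]. split.
{ intros r Hr; destruct (HM r Hr); split; lra. }
split.
{ intros r Hr; destruct (Hnear r Hr). nra. }
split; [exact Hvmu|].
assert (Hl0 : 0 <= ln (1 / r0)).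
{ rewrite <- ln_1; apply ln_le; [lra|].
  apply (Rmult_le_reg_r r0); [lra|]; field_simplify; lra. }
set (l := ln (1 / r0)) in *; clearbody l Y.
split; [nra|].
assert (l <= 2 * Y / 3) by nra.
assert (e * l <= eps / 10 * (2 * Y / 3))
  by (apply Rmult_le_compat; lra).
assert (d * Y <= eps / 1000 * Y) by (apply Rmult_le_compat_r; lra).
apply Rabs_le; split; lra.
Qed.

Theorem theorem1p2
  (p : R) (Hp : 0 < p < 2)
  (h : R -> R)
  (h_nonneg : forall t, 0 <= t -> 0 <= h t)
  (h_C1 : C1_on (fun t => 0 <= t) h)
  (h_pos : exists t0, 0 < t0 /\ forall t, t0 <= t -> 0 < h t)
  (h_lim : is_lim (fun t => Derive h t / (Rpower t (p - 1) * h t)) p_infty 0)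
  (lambda mu : nat -> R) (u : nat -> R -> R)
  (lambda_pos : forall n, 0 < lambda n)
  (mu_pos : forall n, 0 < mu n)
  (u_sol : forall n,
    is_solution (exp_nonlinearity p h) (lambda n) (mu n) (u n))
  (mu_lim : is_lim_seq mu p_infty) :
  exists phi : nat -> nat,
    (forall n, (phi n < phi (S n))%nat) /\
    is_lim_seq (fun n => p * Rpower (mu (phi n)) (p - 1) *
      RInt (fun r => lambda (phi n) *
                     exp_nonlinearity p h (u (phi n) r) * r) 0 1) 4 /\
    is_lim_seq (fun n => p * Rpower (mu (phi n)) (p - 2) *
      RInt (fun r => lambda (phi n) * u (phi n) r *
                     exp_nonlinearity p h (u (phi n) r) * r) 0 1) 4 /\
    is_lim_seq (fun n => ln (1 / lambda (phi n)) / Rpower (mu (phi n)) p)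
      ((2 - p) / 2) /\
    is_lim_seq (fun n => lambda (phi n)) 0 /\
    cvg_C2_loc (fun r => 0 < r <= 1)
      (fun n r => p * Rpower (mu (phi n)) (p - 1) * u (phi n) r)
      (fun r => 4 * ln (1 / r)).
Proof.
set (f := exp_nonlinearity p h) in *.
assert (f0 : forall t, 0 <= t -> 0 <= f t).
{ intros t Ht; apply Rmult_le_pos; [now apply h_nonneg|left; apply exp_pos]. }
assert (Hb : locally_bounded_above f)
  by (apply exp_nonlinearity_locally_bounded; [lra|assumption..]).
assert (Hf : asymptotic_log_derivative p f)
  by (apply exp_nonlinearity_log_derivative; [lra|assumption..]).
destruct (functional_choice _ u_sol) as [u' Hu'].
destruct (functional_choice _ Hu') as [u'' Hu].
clear u_sol Hu'.
set (v := fun n r => u n (clamp r)).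
set (v1 := fun n r => u' n (clamp r)).
set (v2 := fun n r => u'' n (clamp r)).
assert (Hv : forall n, radial_profile f (lambda n) (mu n) (v n) (v1 n) (v2 n)).
{ intros n; destruct (Hu n) as [H1 [H2 [H3 [H4 [H5 [H6 [H7 H8]]]]]]].
  now apply solution_profile. }
assert (mu_large : forall B, eventually (fun n => B <= mu n)).
{ intros B; apply is_lim_seq_spec in mu_lim; destruct (mu_lim B) as [N HN].
  exists N; intros n Hn; left; now apply HN. }
assert (Y_large : forall B, eventually (fun n => B <= Rpower (mu n) p)).
{ intros B; destruct (Rpower_large p B ltac:(lra)) as [M [_ HM]].
  destruct (mu_large M) as [N HN]; exists N; intros n Hn; now apply HM, HN. }
set (A := fun n => p * Rpower (mu n) (p - 1)).
assert (A0 : forall n, 0 < A n)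
  by (intros n; apply Rmult_lt_0_compat; [lra|apply exp_pos]).
assert (Key : forall eps, 0 < eps <= 1 -> eventually (fun n => exists r0, 0 < r0 < 1 /\
    (forall r, r0 <= r <= 1 ->
       4 - eps / 10 <= - A n * (r * v1 n r) <= 4 + eps / 10 /\
       0 <= A n * (lambda n * f (v n r) * r) * r <= eps / 10) /\
    (forall r, 0 <= r <= r0 -> (1 - eps / 10) * mu n <= v n r) /\
    (forall r, 0 <= r <= 1 -> v n r <= mu n) /\
    p / 10 * Rpower (mu n) p <= ln (1 / r0) /\
    Rabs (ln (1 / lambda n) - (2 - p) / 2 * Rpower (mu n) p) <= eps / 2 * Rpower (mu n) p)).
{ intros eps Heps.
  destruct (concentration_asymptotics p f eps Hp Heps f0 Hb Hf) as [mu0 [_ H]].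
  destruct (mu_large mu0) as [N HN]; exists N; intros n Hn.
  apply (H (lambda n) (mu n) (v n) (v1 n) (v2 n)); auto. }
assert (Lim : forall (x : nat -> R) (l : R),
  (forall eps, 0 < eps <= 1 -> eventually (fun n => Rabs (x n - l) < eps)) ->
  is_lim_seq x l).
{ intros x l H; apply is_lim_seq_spec; intros [eps Heps]; simpl.
  assert (G1 := Rmin_l eps 1).
  destruct (H (Rmin eps 1)) as [N HN].
  { split; [apply Rmin_pos; lra|apply Rmin_r]. }
  exists N; intros n Hn; specialize (HN n Hn); lra. }
assert (Ratio : is_lim_seq (fun n => ln (1 / lambda n) / Rpower (mu n) p) ((2 - p) / 2)).
{ apply Lim; intros eps Heps; destruct (Key eps Heps) as [N HN].
  exists N; intros n Hn; destruct (HN n Hn) as [r0 [_ [_ [_ [_ [_ H]]]]]].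
  assert (HY : 0 < Rpower (mu n) p) by apply exp_pos.
  replace (ln (1 / lambda n) / Rpower (mu n) p - (2 - p) / 2) with
    ((ln (1 / lambda n) - (2 - p) / 2 * Rpower (mu n) p) / Rpower (mu n) p) by (field; lra).
  unfold Rdiv at 1; rewrite Rabs_mult, (Rabs_pos_eq (/ _))
    by (left; now apply Rinv_0_lt_compat).
  apply (Rmult_lt_reg_r (Rpower (mu n) p)); [exact HY|].
  rewrite Rmult_assoc, Rinv_l, Rmult_1_r by lra. nra. }
(* The limits hold for the whole sequence, so the identity serves as extraction. *)
exists (fun n => n); split; [intros n; apply Nat.lt_succ_diag_r|].
split; [|split; [|split; [exact Ratio|split]]].
- apply Lim; intros eps Heps; destruct (Key eps Heps) as [N HN].
  exists N; intros n Hn; destruct (HN n Hn) as [r0 [Hr0 [HM _]]].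
  destruct (HM 1 ltac:(lra)) as [HM1 _].
  (* With weight 1 the integral is exactly - v1 n 1, so after multiplication by A it is the value of
     M at 1. *)
  destruct (weighted_mass_bounds f (lambda n) (mu n) (v n) (v1 n) (v2 n) (fun _ => 1) 1 1 0 1
    (lambda_pos n) f0 (Hv n)) as [I [HI I1]]; try lra.
  { intros r; apply continuity_pt_const; now intros ? ?. }
  { intros r Hr; lra. }
  rewrite (is_RInt_unique _ 0 1 I).
  2:{ eapply is_RInt_ext; [|exact HI]. rewrite Rmin_left, Rmax_right by lra.
      intros r Hr; unfold v; rewrite clamp_id by lra. now rewrite Rmult_1_l. }
  fold (A n). replace I with (- v1 n 1) by lra. apply Rabs_def1; lra.
- apply Lim; intros eps Heps; destruct (Key eps Heps) as [N HN].
  exists N; intros n Hn; destruct (HN n Hn) as [r0 [Hr0 [HM [Hnear [Hvmu _]]]]].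
  destruct (Hv n) as [Cv [_ [_ [_ [_ [v0 _]]]]]].
  destruct (HM 1 ltac:(lra)) as [HM1 _]. destruct (HM r0 ltac:(lra)) as [HM0 _].
  (* On [0, r0] the weight u is nearly mu; on [r0, 1] only 0 <= u <= mu is known. The lower bound
     keeps the inner mass M r0 alone, the upper bound uses the total mass M 1. *)
  destruct (weighted_mass_bounds f (lambda n) (mu n) (v n) (v1 n) (v2 n) (v n)
    ((1 - eps / 10) * mu n) (mu n) 0 r0
    (lambda_pos n) f0 (Hv n) Cv) as [I [HI [I1 I2]]]; try lra.
  { intros r Hr; split; [apply Hnear; lra|apply Hvmu; lra]. }
  destruct (weighted_mass_bounds f (lambda n) (mu n) (v n) (v1 n) (v2 n) (v n)
    0 (mu n) r0 1
    (lambda_pos n) f0 (Hv n) Cv) as [J [HJ [J1 J2]]]; try lra.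
  { intros r Hr; split; [apply v0; lra|apply Hvmu; lra]. }
  assert (HIJ := is_RInt_Chasles _ 0 r0 1 I J HI HJ).
  rewrite (is_RInt_unique _ 0 1 (I + J)).
  2:{ eapply is_RInt_ext; [|exact HIJ]. rewrite Rmin_left, Rmax_right by lra.
      intros r Hr; unfold v; rewrite clamp_id by lra. apply Rminus_diag_uniq; ring. }
  assert (HmuA : p * Rpower (mu n) (p - 2) = A n / mu n).
  { unfold A; rewrite (Rpower_succ (mu n) (p - 1)) by auto.
    replace (p - 1 - 1) with (p - 2) by ring. field; apply Rgt_not_eq, mu_pos. }
  rewrite HmuA.
  assert (Hmu := mu_pos n). assert (HA := A0 n).
  assert (HAm : 0 < A n / mu n) by (apply Rmult_lt_0_compat; [lra|now apply Rinv_0_lt_compat]).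
  assert (L : (1 - eps / 10) * (4 - eps / 10) <= A n / mu n * (I + J)).
  { apply Rle_trans with (A n / mu n * ((1 - eps / 10) * mu n * (0 * v1 n 0 - r0 * v1 n r0))).
    - replace (A n / mu n * ((1 - eps / 10) * mu n * (0 * v1 n 0 - r0 * v1 n r0))) with
        ((1 - eps / 10) * (- A n * (r0 * v1 n r0))) by (field; lra).
      apply Rmult_le_compat_l; lra.
    - apply Rmult_le_compat_l; lra. }
  assert (U : A n / mu n * (I + J) <= 4 + eps / 10).
  { apply Rle_trans with (A n / mu n * (mu n * (- (1 * v1 n 1)))).
    - apply Rmult_le_compat_l; lra.
    - replace (A n / mu n * (mu n * (- (1 * v1 n 1)))) with (- A n * (1 * v1 n 1)) by (field; lra).
      lra. }
  apply Rabs_def1; nra.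
- apply Lim; intros eps Heps.
  (* This choice costs half of the limit ratio and leaves ln (1 / lambda) >= (2 - p) / 4 * mu^p; the
     next threshold makes that at least 1 - ln eps. *)
  destruct (Key ((2 - p) / 2)) as [N1 HN1]; [lra|].
  destruct (Y_large (4 / (2 - p) * (1 - ln eps))) as [N2 HN2].
  exists (Nat.max N1 N2); intros n Hn.
  destruct (HN1 n) as [r0 [_ [_ [_ [_ [_ H]]]]]]; [eapply Nat.le_trans; [apply Nat.le_max_l|exact Hn]|].
  specialize (HN2 n (Nat.le_trans _ _ _ (Nat.le_max_r _ _) Hn)).
  assert (Hl := lambda_pos n).
  rewrite Rminus_0_r, Rabs_pos_eq by lra.
  apply ln_lt_inv; [lra..|].
  unfold Rdiv in H at 1; rewrite Rmult_1_l, ln_Rinv in H by lra.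
  apply Rabs_le_between in H.
  assert ((2 - p) / 4 * (4 / (2 - p) * (1 - ln eps)) <= (2 - p) / 4 * Rpower (mu n) p)
    by (apply Rmult_le_compat_l; lra).
  replace ((2 - p) / 4 * (4 / (2 - p) * (1 - ln eps))) with (1 - ln eps) in H0 by (field; lra).
  lra.
- exists (fun n r => A n * u' n r), (fun n r => A n * u'' n r),
    (fun r => - (4 / r)), (fun r => 4 / (r * r)).
  assert (Sub : included (fun r => 0 < r <= 1) (fun r => 0 <= r <= 1)) by (intros r Hr; lra).
  split; [|split; [split; [|split]|]].
  + intros n; destruct (Hu n) as [H1 [H2 [H3 _]]]; split; [|split].
    * intros r Hr; apply Dmult_const, (D_in_included _ _ _ _ _ Sub), H1; lra.
    * intros r Hr; apply Dmult_const, (D_in_included _ _ _ _ _ Sub), H2; lra.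
    * intros r Hr. apply limit_mul; [apply (limit_free (fun _ => A n) _ 0 r)|].
      intros eps Heps; destruct (H3 r ltac:(lra) eps Heps) as [a [Ha H]].
      exists a; split; [exact Ha|]; intros y [[Hy Hy'] Hd]; apply H; split; [split; [now apply Sub|exact Hy']|exact Hd].
  + intros r Hr; apply is_derive_D_in; auto_derive.
    * split; [lra|]. split; [|exact I]. apply Rmult_lt_0_compat; [lra|apply Rinv_0_lt_compat; lra].
    * field; lra.
  + intros r Hr; apply is_derive_D_in; auto_derive; [lra|field; lra].
  + intros r Hr.
    apply cont_deriv with (fun r => - (8 / (r * r * r))).
    apply is_derive_D_in; auto_derive; [nra|field; lra].
  + intros K HK HD; destruct (compact_away_from_0 K HK HD) as [a [Ha HKa]].
    assert (Main : forall eps : posreal, eventually (fun n => forall r, a <= r <= 1 ->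
      Rabs (A n * u n r - 4 * ln (1 / r)) < eps /\
      Rabs (A n * u' n r - - (4 / r)) < eps /\
      Rabs (A n * u'' n r - 4 / (r * r)) < eps)).
    { intros eps; assert (Heps := cond_pos eps).
      (* The worst loss is the division by r^2 >= a^2 in the second derivative; the cap 1 is the
         range of [Key]. *)
      set (del := Rmin 1 (eps * (a * a))).
      assert (Hea : 0 < eps * (a * a)) by (repeat apply Rmult_lt_0_compat; lra).
      assert (Hdel : 0 < del <= 1).
      { split; [apply Rmin_pos; lra|apply Rmin_l]. }
      assert (Hdel2 : del <= eps * (a * a)) by apply Rmin_r.
      destruct (Key del Hdel) as [N1 HN1].
      (* This forces ln (1 / r0) >= ln (1 / a), so [a, 1] lies in the region where M and W are
         controlled. *)
      destruct (Y_large (10 / p * (ln (1 / a)))) as [N2 HN2].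
      exists (Nat.max N1 N2); intros n Hn.
      destruct (HN1 n) as [r0 [Hr0 [HM [_ [_ [Hl _]]]]]]; [eapply Nat.le_trans; [apply Nat.le_max_l|exact Hn]|].
      specialize (HN2 n (Nat.le_trans _ _ _ (Nat.le_max_r _ _) Hn)).
      assert (Hr0a : r0 <= a).
      { assert (p / 10 * (10 / p * ln (1 / a)) <= p / 10 * Rpower (mu n) p)
          by (apply Rmult_le_compat_l; lra).
        replace (p / 10 * (10 / p * ln (1 / a))) with (ln (1 / a)) in H by (field; lra).
        unfold Rdiv in Hl, H; rewrite !Rmult_1_l, !ln_Rinv in * by lra.
        apply Rnot_lt_le; intros N; apply ln_increasing in N; lra. }
      clear Hl HN2.
      assert (HA := A0 n).
      destruct (Hv n) as [Cv [_ [_ [Dv [Eq [_ [_ v10]]]]]]].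
      assert (Hlog := profile_near_log (v n) (v1 n) (A n) (del / 10) a ltac:(lra) Cv
        (fun r Hr => proj1 (Dv r Hr)) v10 (fun r Hr => proj1 (HM r ltac:(lra)))).
      intros r Hr. specialize (Hlog r Hr). specialize (Eq r ltac:(lra)).
      destruct (HM r ltac:(lra)) as [M1 W1].
      unfold v, v1, v2 in *; rewrite clamp_id in * by lra.
      assert (Har : a * a <= r * r) by nra.
      assert (Har' : eps * (a * a) <= eps * (r * r)) by (apply Rmult_le_compat_l; lra).
      assert (Hrr : eps * (r * r) <= eps * r) by (apply Rmult_le_compat_l; nra).
      assert (Haa : eps * (a * a) <= eps * a) by (apply Rmult_le_compat_l; nra).
      split; [|split].
      - eapply Rle_lt_trans; [exact Hlog|].
        assert (ln (1 / a) <= 1 / a).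
        { assert (G := exp_ineq1_le (ln (1 / a))). rewrite exp_ln in G; [lra|].
          apply Rmult_lt_0_compat; [lra|apply Rinv_0_lt_compat; lra]. }
        apply Rle_lt_trans with (del / 10 * (1 / a)); [apply Rmult_le_compat_l; lra|].
        apply (Rmult_lt_reg_r a); [lra|].
        replace (del / 10 * (1 / a) * a) with (del / 10) by (field; lra). lra.
      - replace (A n * u' n r - - (4 / r)) with ((4 - - A n * (r * u' n r)) / r) by (field; lra).
        unfold Rdiv; rewrite Rabs_mult, (Rabs_pos_eq (/ r))
          by (left; apply Rinv_0_lt_compat; lra).
        apply (Rmult_lt_reg_r r); [lra|].
        rewrite Rmult_assoc, Rinv_l, Rmult_1_r by lra. apply Rabs_def1; lra.
      (* By the equation A r^2 u'' = M - W, so the error is ((M - 4) - W) / r^2. *)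
      - replace (A n * u'' n r - 4 / (r * r)) with
          (((- A n * (r * u' n r) - 4) - A n * (lambda n * f (u n r) * r) * r) / (r * r)).
        2:{ replace (lambda n * f (u n r) * r) with (- (r * u'' n r + u' n r)) by lra. field; lra. }
        unfold Rdiv; rewrite Rabs_mult, (Rabs_pos_eq (/ (r * r)))
          by (left; apply Rinv_0_lt_compat; nra).
        apply (Rmult_lt_reg_r (r * r)); [nra|].
        rewrite Rmult_assoc, Rinv_l, Rmult_1_r by nra.
        apply Rabs_def1; lra. }
    split; [|split]; intros eps; destruct (Main eps) as [N HN]; exists N; intros n Hn x Hx;
      apply (HN n Hn x (HKa x Hx)).
Qed.
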